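(* Let $\Gamma$ be a subsemigroup of $\mathrm{GL}_d(\mathbb{R})$ acting irreducibly on $\mathbb{R}^d$, let $r=r_\Gamma$ be its proximal dimension, and let $G$ be the Zariski closure of $\Gamma$ in $\mathrm{GL}_d(\mathbb{R})$. Then $\Gamma$ has property (S) if and only if $G$ has property (S). Moreover, $\Gamma$ has property (S) if and only if $$\forall V\in\mathrm{Gr}(r,d),\ \exists\pi\in\Pi_\Gamma,\quad V\cap\ker\pi=\{0\}.$$
   Context: $\mathrm{Gr}(k,d)$ is the Grassmannian of $k$-dimensional linear subspaces of $\mathbb{R}^d$. The Zariski closure $G$ of $\Gamma$ in $\mathrm{GL}_d(\mathbb{R})$ means the set of real points of the Zariski closure. For a subsemigroup $\Gamma\subset\mathrm{GL}_d(\mathbb{R})$ (in particular for $G$ itself), let $\overline{\mathbb{R}\Gamma}$ be the closure in $\mathrm{End}(\mathbb{R}^d)$ of $\{\lambda g\mid\lambda\in\mathbb{R},\ g\in\Gamma\}$. The proximal dimension is $r_\Gamma=\min\{\operatorname{rk}\pi\mid\pi\in\overline{\mathbb{R}\Gamma}\setminus\{0\}\}$, and $\Pi_\Gamma=\{\pi\in\overline{\mathbb{R}\Gamma}\mid\operatorname{rk}\pi=r_\Gamma\}$. $\Gamma$ has property (S) if for every $W\in\mathrm{Gr}(d-r_\Gamma,d)$ there exists $\pi\in\Pi_\Gamma$ with $\operatorname{im}\pi\cap W=\{0\}$. *)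

(* Defs.v *)
From HB Require Import structures.
From mathcomp Require Import all_boot all_order all_algebra.
From mathcomp Require Import all_classical all_reals all_analysis.
From mathcomp Require mpoly.

Set Implicit Arguments.
Unset Strict Implicit.
Unset Printing Implicit Defensive.

Import Order.TTheory GRing.Theory Num.Theory.
Import numFieldNormedType.Exports.

Local Open Scope classical_set_scope.
Local Open Scope ring_scope.

Section ProximalDimension.
Variables (R : realType) (d : nat).
Implicit Types (S : set 'M[R]_d) (p g : 'M[R]_d).

(* Matrices act on column vectors; this is the endomorphism v |-> p *m v. *)
Definition mx_end p : 'End('cV[R]_d) := linfun (mulmx p).

Lemma mx_endE p v : mx_end p v = p *m v.
Proof. by rewrite lfunE. Qed.

(* A semigroup is nonempty, so that the minimum in proximal_dim exists. *)
Definition subsemigroup_GL S : Prop :=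
  [/\ S !=set0,
      forall g, S g -> g \in unitmx
    & forall g h, S g -> S h -> S (g *m h)].

(* The zero space is not irreducible. *)
Definition acts_irreducibly S : Prop :=
  (0 < d)%N /\
  forall W : {vspace 'cV[R]_d},
    (forall g, S g -> (mx_end g @: W <= W)%VS) ->
    W = 0%VS \/ W = fullv.

Definition real_cone_closure S : set 'M[R]_d :=
  closure [set l *: g | l in [set: R] & g in S].

Definition proximal_ranks S : set nat :=
  [set \rank p | p in real_cone_closure S `\ 0].

(* Ranks are at most d, so the bound d does not affect the minimum as soon as
   proximal_ranks S is nonempty; see proximal_dimP. *)
Definition proximal_dim S : nat :=
  \big[minn/d]_(k < d.+1 | `[< proximal_ranks S k >]) k.

Lemma proximal_ranks_neq0 S :
  subsemigroup_GL S -> (0 < d)%N -> proximal_ranks S !=set0.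
Proof.
move=> [[g Sg] Su _] d_gt0; exists (\rank g); exists g => //; split.
  by apply: subset_closure; exists 1 => //; exists g => //; rewrite scale1r.
move=> /= g0; have /mxrank_unit := Su g Sg.
by rewrite g0 mxrank0 => d0; rewrite -d0 in d_gt0.
Qed.

Lemma proximal_dimP S : proximal_ranks S !=set0 ->
  proximal_ranks S (proximal_dim S) /\
  forall k, proximal_ranks S k -> (proximal_dim S <= k)%N.
Proof.
have le_d k : proximal_ranks S k -> (k < d.+1)%N.
  by move=> [p _ <-]; rewrite ltnS rank_leq_row.
have lb k : proximal_ranks S k -> (proximal_dim S <= k)%N.
  move=> Sk; rewrite /proximal_dim.
  rewrite -minEnat -leEnat.
  apply: (@bigmin_le_cond _ _ _ _ (Ordinal (le_d k Sk)) _ val).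
  exact/asboolP.
move=> [k0 Sk0]; split=> //.
have : proximal_ranks S (proximal_dim S) \/ proximal_dim S = d.
  rewrite /proximal_dim.
  elim/big_rec: _ => [|k m /asboolP Sk IH]; first by right.
  by rewrite /minn; case: ifP => _; [left|].
case=> // Sd; have := lb _ Sk0; rewrite Sd => le_dk0.
suff -> : d = k0 by [].
by apply/eqP; rewrite eqn_leq le_dk0 -ltnS le_d.
Qed.

Definition minimal_rank_set S : set 'M[R]_d :=
  [set p | real_cone_closure S p /\ \rank p = proximal_dim S].

Definition property_S S : Prop :=
  forall W : {vspace 'cV[R]_d}, \dim W = (d - proximal_dim S)%N ->
    exists2 p, minimal_rank_set S p & (limg (mx_end p) :&: W)%VS = 0%VS.

(* Polynomials in the d * d matrix entries, the entries being enumerated by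
   mxvec. *)
Definition mx_poly : Type := mpoly.mpoly (d * d)%N R.

Definition mx_poly_eval (f : mx_poly) g : R := mpoly.meval (mxvec g 0) f.

(* A regular function on GL_d is f / \det ^+ n with f a polynomial in the
   entries, and has the same zeros in GL_d as f.  Complex coefficients would give
   the same set, as the points of S and of GL_d here are real. *)
Definition zariski_closure_GL S : set 'M[R]_d :=
  [set g | g \in unitmx /\
    forall f : mx_poly, (forall h, S h -> mx_poly_eval f h = 0) ->
      mx_poly_eval f g = 0].

End ProximalDimension.

(* Main.v *)
(* Write r for the proximal dimension of Gamma, M for the closure of the cone over
   Gamma, and fix pi = B C in M of rank r, with B injective and C surjective.

   The corners C p B, p in M, form a semigroup whose elements are 0 or invertible;
   normalised to determinant 1 or -1 they are bounded, hence preserve a positive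
   definite form Q.  So each C p B is a similarity of Q.  This is a polynomial
   condition on p, so it holds over the Zariski closure G; with irreducibility it gives
   G and Gamma the same proximal dimension.  Property (S) passes from G to Gamma
   because im (g pi) meeting W is the polynomial condition det (L g B) = 0, where
   ker L = W.

   For the last equivalence let Y be the span, inside the r-th tensor power, of the
   Plucker vectors of all such C; it is stable under Gamma.  The failing V are those
   whose pure tensor is orthogonal to Y.  If some scalar product makes Y stable under
   the adjoint of Gamma as well, then Y contains the Plucker vector of
   C pi' = (C C') B', hence that of B', where ' is the adjoint, and the orthogonal W
   of a failing V meets every im pi.  Such a scalar product is given by a minimum over h of
       |volume of h Y|^2 + sum_i |log (T_i T_i^T)|^2,  T_i = h^-1 g_i h,  det h = 1,
   for finitely many g_i spanning Gamma: the second term is proper by irreducibility,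
   and by Jensen's inequality it decreases to first order along the gradient flow of
   the first one, so that at the minimum the gradient (moment) of the first term
   vanishes, as in Kempf-Ness theory.  The converse is the same statement for the
   transposed semigroup. *)
Require Import Defs.
From HB Require Import structures.
From mathcomp Require Import all_boot all_order all_algebra.
From mathcomp Require Import perm ring lra.
From mathcomp Require Import all_classical all_reals all_analysis.
From mathcomp Require Import(canonicals) mpoly.

Set Implicit Arguments.
Unset Strict Implicit.
Unset Printing Implicit Defensive.

Import Order.TTheory GRing.Theory Num.Theory.
Import numFieldNormedType.Exports.

Local Open Scope classical_set_scope.
Local Open Scope ring_scope.

(** * Topology of matrix spaces *)

Section Continuity.
Variables (R : realType) (T : topologicalType).

Lemma continuous_mx m n (f : T -> 'M[R]_(m, n)) :
  (forall i j, continuous (fun x => f x i j)) -> continuous f.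
Proof.
move=> cf x A /= [P nP sPA]; apply: filterS; first exact: sPA.
rewrite /=; apply: filter_forall => i; apply: filter_forall => j.
exact: (cf i j x _ (nP i j)).
Qed.

Lemma continuous_add (f g : T -> R) :
  continuous f -> continuous g -> continuous (fun x => f x + g x).
Proof. by move=> cf cg x; apply: continuousD; [exact: cf|exact: cg]. Qed.

Lemma continuous_opp (f : T -> R) : continuous f -> continuous (fun x => - f x).
Proof. by move=> cf x; apply: continuousN; exact: cf. Qed.

Lemma continuous_mul (f g : T -> R) :
  continuous f -> continuous g -> continuous (fun x => f x * g x).
Proof. by move=> cf cg x; apply: continuousM; [exact: cf|exact: cg]. Qed.

Lemma continuous_entry m n (f : T -> 'M[R]_(m, n)) i j :
  continuous f -> continuous (fun x => f x i j).
Proof.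
move=> cf x; apply: (@continuous_comp _ _ _ f (fun M : 'M[R]_(m, n) => M i j)).
  exact: cf.
exact: coord_continuous.
Qed.

Lemma continuous_bigsum (I : Type) (s : seq I) (P : pred I) (F : I -> T -> R) :
  (forall i, P i -> continuous (F i)) ->
  continuous (fun x => \sum_(i <- s | P i) F i x).
Proof.
move=> cF; elim: s => [|i s IH].
  by rewrite (_ : (fun x => _) = fun=> 0);
    [exact: cst_continuous|apply/funext => x; rewrite big_nil].
have [Pi|nPi] := boolP (P i); last first.
  rewrite (_ : (fun x => _) = fun x => \sum_(j <- s | P j) F j x) //.
  by apply/funext => x; rewrite big_cons (negbTE nPi).
rewrite (_ : (fun x => _) = fun x => F i x + \sum_(j <- s | P j) F j x).
  by move=> x; exact: (continuousD (cF i Pi x) (IH x)).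
by apply/funext => x; rewrite big_cons Pi.
Qed.

Lemma continuous_bigprod (I : Type) (s : seq I) (P : pred I) (F : I -> T -> R) :
  (forall i, P i -> continuous (F i)) ->
  continuous (fun x => \prod_(i <- s | P i) F i x).
Proof.
move=> cF; elim: s => [|i s IH].
  by rewrite (_ : (fun x => _) = fun=> 1);
    [exact: cst_continuous|apply/funext => x; rewrite big_nil].
have [Pi|nPi] := boolP (P i); last first.
  rewrite (_ : (fun x => _) = fun x => \prod_(j <- s | P j) F j x) //.
  by apply/funext => x; rewrite big_cons (negbTE nPi).
rewrite (_ : (fun x => _) = fun x => F i x * \prod_(j <- s | P j) F j x).
  by move=> x; exact: (continuousM (cF i Pi x) (IH x)).
by apply/funext => x; rewrite big_cons Pi.
Qed.

Lemma continuous_mulmx m n p (f : T -> 'M[R]_(m, n)) (g : T -> 'M[R]_(n, p)) :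
  continuous f -> continuous g -> continuous (fun x => f x *m g x).
Proof.
move=> cf cg; apply: continuous_mx => i j.
under eq_fun do rewrite mxE; apply: continuous_bigsum => k _.
by apply: continuous_mul; exact: continuous_entry.
Qed.

Lemma continuous_trmx m n (f : T -> 'M[R]_(m, n)) :
  continuous f -> continuous (fun x => (f x)^T).
Proof.
move=> cf; apply: continuous_mx => i j.
by under eq_fun do rewrite mxE; exact: continuous_entry.
Qed.

Lemma continuous_det n (f : T -> 'M[R]_n) :
  continuous f -> continuous (fun x => \det (f x)).
Proof.
move=> cf; apply: continuous_bigsum => s _.
apply: continuous_mul; first exact: cst_continuous.
by apply: continuous_bigprod => i _; exact: continuous_entry.
Qed.

Lemma continuous_adjmx n (f : T -> 'M[R]_n) :
  continuous f -> continuous (fun x => \adj (f x)).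
Proof.
move=> cf; apply: continuous_mx => i j.
under eq_fun do rewrite mxE; apply: continuous_mul; first exact: cst_continuous.
apply: continuous_det; apply: continuous_mx => k l.
by under eq_fun do rewrite !mxE; exact: continuous_entry.
Qed.

End Continuity.

(** * Compactness and extreme values in matrix spaces *)

Section Compactness.
Variable R : realType.

Lemma closed_preimage_eq (T : topologicalType) (f : T -> R) c :
  continuous f -> closed [set x | f x = c].
Proof.
by move=> /continuous_closedP/(_ _ (@closed_eq _ c)).
Qed.

Lemma closed_preimage_le (T : topologicalType) (f : T -> R) c :
  continuous f -> closed [set x | f x <= c].
Proof. by move=> /continuous_closedP/(_ _ (@closed_le _ c)). Qed.

Lemma closed_preimage_ge (T : topologicalType) (f : T -> R) c :
  continuous f -> closed [set x | c <= f x].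
Proof. by move=> /continuous_closedP/(_ _ (@closed_ge _ c)). Qed.

Lemma closed_forall (T : topologicalType) (I : Type) (P : I -> T -> Prop) :
  (forall i, closed [set x | P i x]) -> closed [set x | forall i, P i x].
Proof.
move=> clP; rewrite (_ : mkset _ = \bigcap_(i in setT) [set x | P i x]).
  by apply: closed_bigI => i _; exact: clP.
by apply/seteqP; split=> [x Px i _|x Px i]; [exact: Px|apply: (Px i)].
Qed.

Lemma closed_imply (T : topologicalType) (Q : Prop) (P : T -> Prop) :
  (Q -> closed [set x | P x]) -> closed [set x | Q -> P x].
Proof.
move=> clP; have [q|nq] := pselect Q.
  by rewrite (_ : mkset _ = [set x | P x]);
    [exact: clP|apply/seteqP; split=> x /=; tauto].
by rewrite (_ : mkset _ = setT);
  [exact: closedT|apply/seteqP; split=> x //= _ /nq].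
Qed.

Lemma le_mx_norm m n (M : 'M[R]_(m, n)) i j : `|M i j| <= `|M|.
Proof.
rewrite [leRHS]/Num.norm /= mx_normrE.
by apply/bigmax_geP; right => /=; exists (i, j).
Qed.

Lemma mx_norm_le m n (M : 'M[R]_(m, n)) c :
  0 <= c -> (forall i j, `|M i j| <= c) -> `|M| <= c.
Proof.
move=> c0 Mc; rewrite [leLHS]/Num.norm /= mx_normrE.
by apply/bigmax_leP; split=> // -[i j] _; exact: Mc.
Qed.

(** Heine-Borel for row vectors, transported along the continuous bijection [vec_mx]. *)
Lemma compact_mx m n (A : set 'M[R]_(m, n)) c :
  closed A -> (forall M, A M -> `|M| <= c) -> compact A.
Proof.
move=> clA bA; rewrite (_ : A = vec_mx @` [set v | A (vec_mx v)]); last first.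
  apply/seteqP; split=> [M AM|_ [v Av <-]//].
  by exists (mxvec M); rewrite /= mxvecK.
have cvec : continuous (@vec_mx R m n).
  by apply: continuous_mx => i j; under eq_fun do rewrite mxE; exact: coord_continuous.
apply: continuous_compact; first exact: continuous_subspaceT.
apply: bounded_closed_compact.
  exists c; split; first exact: num_real.
  move=> x cx v Av /=.
  have c0 : 0 <= c by rewrite (le_trans _ (bA _ Av)).
  apply: mx_norm_le => [|i j]; first by rewrite (le_trans c0)// ltW.
  rewrite ord1; case/mxvec_indexP: j => k l; rewrite -[v]vec_mxK mxvecE.
  by rewrite (le_trans (le_mx_norm _ _ _))// (le_trans (bA _ Av))// ltW.
by move: cvec => /continuous_closedP/(_ _ clA).
Qed.

Lemma compact_argmin (T : topologicalType) (f : T -> R) (A : set T) :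
  A !=set0 -> compact A -> continuous f ->
  exists2 c, A c & forall t, A t -> f c <= f t.
Proof.
move=> A0 cA cf.
have [c /set_mem Ac fc] := compact_EVT_min A0 cA (continuous_subspaceT cf).
by exists c => // t At; apply: fc; exact/mem_set.
Qed.

End Compactness.

(** * The closure of the real cone over a set of matrices *)

Section ConeClosure.
Variables (R : realType) (d : nat).
Implicit Types (S : set 'M[R]_d) (p q g : 'M[R]_d).

Lemma closure_min (T : topologicalType) (A C : set T) :
  A `<=` C -> closed C -> closure A `<=` C.
Proof. by move=> AC clC; rewrite (closure_id C).1//; exact: closure_subset. Qed.

(** Serves as the elimination rule for the cone closure: a closed condition only has to be checked
    on the multiples [l *: g]. *)
Lemma cone_closure_min S (C : set 'M[R]_d) :
  closed C -> (forall l g, S g -> C (l *: g)) -> real_cone_closure S `<=` C.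
Proof.
by move=> clC SC; apply: closure_min => // _ [l _] [g Sg] <-; exact: SC.
Qed.

Lemma closed_cone_closure S : closed (real_cone_closure S).
Proof. exact: closed_closure. Qed.

Lemma cone_closure_mem S l g : S g -> real_cone_closure S (l *: g).
Proof. by move=> Sg; apply: subset_closure; exists l => //; exists g. Qed.

Lemma cone_closure_sub S g : S g -> real_cone_closure S g.
Proof. by rewrite -{2}[g]scale1r; exact: cone_closure_mem. Qed.

Lemma closed_preimage (T U : topologicalType) (f : T -> U) (C : set U) :
  continuous f -> closed C -> closed (fun x => C (f x)).
Proof. by move=> /continuous_closedP cf /cf. Qed.

Lemma cone_closureZ S l p :
  real_cone_closure S p -> real_cone_closure S (l *: p).
Proof.
move: p; apply: cone_closure_min => [|k g Sg].
  apply: (@closed_preimage _ _ (fun x : 'M[R]_d => l *: x) _ _ (@closed_cone_closure S)).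
  by move=> x; apply: continuousZr; exact: cvg_id.
by rewrite scalerA; exact: cone_closure_mem.
Qed.

Lemma cone_closure_mono S S' :
  S `<=` S' -> real_cone_closure S `<=` real_cone_closure S'.
Proof.
move=> SS'; apply: cone_closure_min => [|l g /SS'].
  exact: closed_cone_closure.
exact: cone_closure_mem.
Qed.

Lemma cone_closureM S : (forall g h, S g -> S h -> S (g *m h)) ->
  forall p q, real_cone_closure S p -> real_cone_closure S q ->
  real_cone_closure S (p *m q).
Proof.
(* Density is used twice, first in the left factor with [q] fixed, then in the right factor with the
   left one equal to [l *: g]. *)
move=> SM p q Sp Sq; move: p Sp; apply: cone_closure_min => [|l g Sg].
  apply: (@closed_preimage _ _ (fun x : 'M[R]_d => x *m q) _ _ (@closed_cone_closure S)).
  by apply: continuous_mulmx; [move=> x; exact: cvg_id|exact: cst_continuous].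
move: q Sq; apply: cone_closure_min => [|k h Sh].
  apply: (@closed_preimage _ _ (fun x : 'M[R]_d => (l *: g) *m x) _ _ (@closed_cone_closure S)).
  by apply: continuous_mulmx; [exact: cst_continuous|move=> x; exact: cvg_id].
rewrite -scalemxAl -scalemxAr scalerA; apply: cone_closure_mem; exact: SM.
Qed.

Lemma cone_closure_tr S p :
  real_cone_closure S p -> real_cone_closure [set g^T | g in S] p^T.
Proof.
move: p; apply: cone_closure_min => [|l g Sg].
  apply: (@closed_preimage _ _ (fun x : 'M[R]_d => x^T) _ _ (@closed_cone_closure _)).
  by apply: continuous_trmx => x; exact: cvg_id.
by rewrite linearZ; apply: cone_closure_mem; exists g.
Qed.

End ConeClosure.

(** * Spectral theorem for real symmetric matrices *)

Section LinearAlgebra.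

(** A subspace of maximal dimension among those contained in [P] must contain every vector of [P],
    since adjoining the line of a missing one would stay inside [P]. *)
Lemma vspace_of_linear_closed (K : fieldType) (vT : vectType K) (P : vT -> Prop) :
  P 0 -> (forall a u v, P u -> P v -> P (a *: u + v)) ->
  exists U : {vspace vT}, forall v, v \in U <-> P v.
Proof.
move=> P0 PD.
pose Q n := `[< exists U : {vspace vT}, (forall v, v \in U -> P v) /\ \dim U = n >].
have Q0 : exists n, Q n.
  exists 0%N; apply/asboolP; exists 0%VS; rewrite dimv0; split=> // v.
  by rewrite memv0 => /eqP ->.
have Qb n : Q n -> (n <= dim vT)%N.
  by move=> /asboolP [U [_ <-]]; rewrite -dimvf dimvS// subvf.
case: (ex_maxnP Q0 Qb) => n /asboolP [U [UP dU]] nmax.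
exists U => v; split=> [|Pv]; first exact: UP.
have [//|vU] := boolP (v \in U).
have /nmax : Q (\dim (<[v]> + U)).
  apply/asboolP; exists (<[v]> + U)%VS; split=> // w /memv_addP [u /vlineP [a ->]].
  by move=> [u' /UP Pu' ->]; exact: PD.
rewrite -dU => dvU; have : (U == <[v]> + U)%VS.
  by rewrite eqEdim addvSr dvU.
move=> /eqP UE; move: vU; rewrite UE => /negP[].
by apply: (subvP (addvSl _ _)); exact: memv_line.
Qed.

(** A free family in [E] of maximal length spans [E]. This extracts finitely many elements of the
    semigroup that span it linearly, and a basis made of Plucker vectors. *)
Lemma spanning_rows (K : fieldType) N (E : 'rV[K]_N -> Prop) :
  exists k (y : 'M[K]_(k, N)),
    [/\ row_free y, forall i, E (row i y) & forall v, E v -> (v <= y)%MS].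
Proof.
pose Q k := `[< exists y : 'M[K]_(k, N), row_free y /\ forall i, E (row i y) >].
have Q0 : exists k, Q k.
  by exists 0%N; apply/asboolP; exists 0; split=> [|[]//]; rewrite /row_free mxrank0.
have Qb k : Q k -> (k <= N)%N.
  by move=> /asboolP [y [yfree _]]; rewrite -(eqP yfree) rank_leq_col.
case: (ex_maxnP Q0 Qb) => k /asboolP [y [yfree yE]] kmax.
exists k, y; split=> // v Ev; apply: contrapT => /negP nvy.
suff /kmax : Q k.+1 by rewrite ltnn.
rewrite -addn1; apply/asboolP; exists (col_mx y v); split; last first.
  move=> i; case: (splitP i) => j ij.
    have -> : i = lshift 1 j by apply: val_inj.
    by rewrite rowKu.
  have -> : i = rshift k j by apply: val_inj.
  by rewrite rowKd row_id.
rewrite /row_free eqn_leq rank_leq_row /= -addsmxE addn1 -{1}(eqP yfree).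
by rewrite rank_ltmx// /ltmx addsmxSl addsmx_sub submx_refl (negbTE nvy).
Qed.

End LinearAlgebra.

(** Irreducibility expressed by matrix coefficients: this form is self-dual, so it passes to the
    transposed semigroup. *)
Definition bi_irreducible (R : realType) d (S : set 'M[R]_d) :=
  forall m n (p : 'M[R]_(m, d)) (q : 'M[R]_(d, n)), p != 0 -> q != 0 ->
  exists2 g, S g & p *m g *m q != 0.

Lemma bi_irreducible_tr (R : realType) d (S : set 'M[R]_d) :
  bi_irreducible S -> bi_irreducible [set g^T | g in S].
Proof.
move=> irrS m n p q p0 q0; have [||g Sg] := irrS _ _ q^T p^T.
- by rewrite trmx_eq0.
- by rewrite trmx_eq0.
move=> qgp; exists g^T; first by exists g.
by rewrite -trmx_eq0 !trmx_mul trmxK mulmxA.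
Qed.

(** If every [p *m g *m q] vanishes, consider the invariant subspace of the vectors killed by all
    [p *m g]: if it is 0 then [q] vanishes, and if it is everything then [p] does. *)
Lemma irreducible_bi_irreducible (R : realType) d (S : set 'M[R]_d) :
  subsemigroup_GL S -> acts_irreducibly S -> bi_irreducible S.
Proof.
move=> [[g0 Sg0] Su SM] [d0 irrS] m n p q p0 q0; apply: contrapT => npq.
have pgq0 g : S g -> p *m g *m q = 0.
  move=> Sg; have [//|/eqP pgq] := eqVneq (p *m g *m q) 0.
  by case: npq; exists g => //; exact/eqP.
have [|a u v Pu Pv|W WP] := @vspace_of_linear_closed R 'cV[R]_d
    (fun v => forall g, S g -> p *m g *m v = 0).
- by move=> g _; rewrite mulmx0.
- by move=> g Sg; rewrite mulmxDr -scalemxAr Pu// Pv// scaler0 addr0.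
have [g Sg|W0|WT] := irrS W.
- apply/subvP => _ /memv_imgP [v /WP Wv ->]; apply/WP => h Sh.
  by rewrite mx_endE mulmxA -(mulmxA p) Wv//; exact: SM.
- case/eqP: q0; apply/matrixP => i j; rewrite mxE.
  have : col j q \in W by apply/WP => g Sg; rewrite colE mulmxA pgq0// mul0mx.
  by rewrite W0 memv0 => /eqP/matrixP/(_ i 0); rewrite !mxE.
- case/eqP: p0; rewrite -[p](mulmxK (Su _ Sg0)) [X in X *m _](_ : _ = 0) ?mul0mx//.
  apply/matrixP => i j; rewrite [RHS]mxE.
  have /WP/(_ _ Sg0) : (delta_mx j 0 : 'cV[R]_d) \in W by rewrite WT memvf.
  by rewrite -colE => /matrixP/(_ i 0); rewrite !mxE.
Qed.

Lemma trmxZ (R : pzRingType) m n k (A : 'M[R]_(m, n)) : (k *: A)^T = k *: A^T.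
Proof. exact: linearZ. Qed.

(** * The squared Frobenius norm and positive semidefinite forms *)

Section Frobenius.
Variable R : realType.

Definition frob m n (A : 'M[R]_(m, n)) : R := \sum_i \sum_j A i j ^+ 2.

Lemma frobE m n (A : 'M[R]_(m, n)) : frob A = \tr (A^T *m A).
Proof.
rewrite /frob /mxtrace exchange_big; apply: eq_bigr => j _.
by rewrite mxE; apply: eq_bigr => i _; rewrite mxE expr2.
Qed.

Lemma frob_ge0 m n (A : 'M[R]_(m, n)) : 0 <= frob A.
Proof. by apply: sumr_ge0 => i _; apply: sumr_ge0 => j _; exact: sqr_ge0. Qed.

Lemma frob_entry m n (A : 'M[R]_(m, n)) i j : A i j ^+ 2 <= frob A.
Proof.
rewrite /frob (bigD1 i)//= (bigD1 j)//= -addrA lerDl addr_ge0//.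
  by apply: sumr_ge0 => k _; exact: sqr_ge0.
by apply: sumr_ge0 => k _; apply: sumr_ge0 => l _; exact: sqr_ge0.
Qed.

Lemma frob_eq0 m n (A : 'M[R]_(m, n)) : frob A = 0 -> A = 0.
Proof.
move=> A0; apply/matrixP => i j; rewrite mxE; apply/eqP.
by rewrite -sqrf_eq0 eq_le sqr_ge0 andbT -A0 frob_entry.
Qed.

Lemma frob_gt0 m n (A : 'M[R]_(m, n)) : A != 0 -> 0 < frob A.
Proof. by rewrite lt_def frob_ge0 andbT; apply: contraNneq => /frob_eq0 ->. Qed.

Lemma frob_delta m n (i : 'I_m) (j : 'I_n) : frob (delta_mx i j : 'M[R]_(m, n)) = 1.
Proof.
rewrite /frob (bigD1 i)//= (bigD1 j)//= mxE !eqxx expr1n !big1 ?addr0// => k ki.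
  by rewrite big1// => l _; rewrite mxE (negbTE ki) expr0n.
by rewrite mxE (negbTE ki) andbF expr0n.
Qed.

Lemma frob_vecE n (v : 'cV[R]_n) : (v^T *m v) 0 0 = frob v.
Proof. by rewrite frobE /mxtrace big_ord1. Qed.

Lemma continuous_frob (T : topologicalType) m n (f : T -> 'M[R]_(m, n)) :
  continuous f -> continuous (fun x => frob (f x)).
Proof.
move=> cf; apply: continuous_bigsum => i _; apply: continuous_bigsum => j _.
by under eq_fun do rewrite expr2; apply: continuous_mul; exact: continuous_entry.
Qed.

(** Positivity of the form at [x - t *: (B *m x)] for all [t] is a quadratic inequality in [t]
    without constant term. Its linear coefficient, a multiple of [frob (B *m x)], must therefore
    vanish. *)
Lemma psd_null n (B : 'M[R]_n) (x : 'cV[R]_n) : B^T = B ->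
  (forall y : 'cV[R]_n, 0 <= (y^T *m B *m y) 0 0) ->
  (x^T *m B *m x) 0 0 = 0 -> B *m x = 0.
Proof.
move=> Bs Bp x0; set y := B *m x.
pose c := frob y; pose e := (y^T *m B *m y) 0 0.
have e0 : 0 <= e by exact: Bp.
have c0 : 0 <= c by exact: frob_ge0.
have q t : 0 <= - (2 * t * c) + t ^+ 2 * e.
  have := Bp (x - t *: y); congr (0 <= _).
  have E1 : (x^T *m B *m y) 0 0 = c by rewrite /c -frob_vecE /y trmx_mul Bs.
  have E2 : (y^T *m B *m x) 0 0 = c by rewrite /c -frob_vecE -mulmxA.
  have -> : (x - t *: y)^T *m B *m (x - t *: y) = x^T *m B *m x -
      t *: (x^T *m B *m y) - t *: (y^T *m B *m x) + t ^+ 2 *: (y^T *m B *m y).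
    have -> : (x - t *: y)^T = x^T - t *: y^T by rewrite linearB linearZ.
    rewrite !(mulmxBl, mulmxBr) -!(scalemxAl, scalemxAr).
    by rewrite scalerA -expr2 opprB addrA addrAC -!addrA; congr (_ + _); rewrite addrCA.
  have mxD (M N : 'M[R]_1) : (M + N) 0 0 = M 0 0 + N 0 0 by rewrite mxE.
  have mxZ k (M : 'M[R]_1) : (k *: M) 0 0 = k * M 0 0 by rewrite mxE.
  have mxN (M : 'M[R]_1) : (- M) 0 0 = - M 0 0 by rewrite mxE.
  by rewrite !(mxD, mxN, mxZ) x0 E1 E2 -/e; ring.
have [/frob_eq0//|c0'] := eqVneq c 0.
have cp : 0 < c by rewrite lt_def c0' c0.
exfalso.
have ep : 0 < e + 1 by rewrite ltr_wpDl.
(* The value [t = c / (e + 1)] makes the quadratic negative; [e + 1] replaces the optimal [e], which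
   may be 0. *)
have := q (c / (e + 1)); apply/negP; rewrite -ltNge.
have -> : - (2 * (c / (e + 1)) * c) + (c / (e + 1)) ^+ 2 * e =
   - (c / (e + 1)) ^+ 2 * (e + 2).
  by field; rewrite gt_eqF.
by rewrite mulNr oppr_lt0 mulr_gt0// ?exprn_gt0 ?divr_gt0// ltr_wpDl.
Qed.

End Frobenius.

Section Spectral.
Variable R : realType.

(** A maximiser [x] of the Rayleigh quotient on the unit sphere, with value [l], is a null vector of
    the positive semidefinite form [l%:M - A], hence lies in its kernel. *)
Lemma symmetric_eigenvector n (A : 'M[R]_n.+1) : A^T = A ->
  exists l (x : 'cV[R]_n.+1), frob x = 1 /\ A *m x = l *: x.
Proof.
move=> As; pose sph := [set v : 'cV[R]_n.+1 | frob v = 1].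
have sphc : compact sph.
  apply: (@compact_mx _ _ _ _ 1).
    by apply: closed_preimage_eq; apply: continuous_frob => x; exact: cvg_id.
  move=> v /= v1; apply: mx_norm_le => // i j.
  by rewrite -(@ler_pXn2r _ 2)// ?nnegrE// expr1n real_normK ?num_real// -v1 frob_entry.
have sph0 : sph !=set0.
  by exists (delta_mx 0 0); exact: frob_delta.
pose f (v : 'cV[R]_n.+1) : R := - (v^T *m A *m v) 0 0.
have cf : continuous f.
  move=> v; apply: continuousN; move: v; apply: continuous_entry.
  have cid : continuous (fun v : 'cV[R]_n.+1 => v) by move=> x; exact: cvg_id.
  apply: continuous_mulmx => //; apply: continuous_mulmx; last exact: cst_continuous.
  exact: continuous_trmx.
have [x x1 xmin] := compact_argmin sph0 sphc cf.
pose l := (x^T *m A *m x) 0 0; exists l, x; split => //.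
pose B := l%:M - A.
have BE (y : 'cV[R]_n.+1) : (y^T *m B *m y) 0 0 = l * frob y - (y^T *m A *m y) 0 0.
  by rewrite mulmxBr mulmxBl mul_mx_scalar -scalemxAl mxE [in X in X + _]mxE
     frob_vecE [in X in _ + X]mxE.
apply/esym/eqP; rewrite -subr_eq0 -mul_scalar_mx -mulmxBl; apply/eqP.
apply: (psd_null (B := B)) => [|y|].
- by rewrite linearB /= tr_scalar_mx As.
- rewrite BE subr_ge0; have [->|y0] := eqVneq y 0.
    by rewrite frobE !mulmx0 mxtrace0 mulr0 mxE.
  have fy := frob_gt0 y0.
  pose k := (Num.sqrt (frob y))^-1.
  have k2 : k ^+ 2 = (frob y)^-1 by rewrite exprVn sqr_sqrtr// ltW.
  have frobZ : frob (k *: y) = 1.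
    rewrite -frob_vecE trmxZ -scalemxAl -scalemxAr scalerA -expr2 k2.
    by rewrite mxE frob_vecE mulVf// gt_eqF.
  have := xmin _ frobZ; rewrite /f lerN2 -/l trmxZ -!scalemxAl -scalemxAr.
  by rewrite scalerA -expr2 k2 mxE mulrC ler_pdivrMr.
- by rewrite BE x1 mulr1 subrr.
Qed.

(** Reflection in the hyperplane orthogonal to [x - e], where [e] is the first basis vector. *)
Lemma householder n (x : 'cV[R]_n.+1) : frob x = 1 ->
  exists H : 'M[R]_n.+1, [/\ H^T = H, H *m H = 1%:M & H *m delta_mx 0 0 = x].
Proof.
move=> x1; pose e : 'cV[R]_n.+1 := delta_mx 0 0; pose w := x - e.
have [xe|xe] := eqVneq x e.
  by exists 1%:M; rewrite trmx1 !mul1mx.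
have w0 : w != 0 by rewrite subr_eq0.
have cp := frob_gt0 w0; set c := frob w in cp.
have wwE : w^T *m w = c%:M by rewrite [LHS]mx11_scalar frob_vecE.
have we : w^T *m e = (- (c / 2))%:M.
  rewrite [LHS]mx11_scalar; congr _%:M.
  have ee : frob e = 1 by exact: frob_delta.
  have xeE : (x^T *m e) 0 0 = (e^T *m x) 0 0.
    by rewrite -[in LHS](trmxK e) -trmx_mul mxE.
  have mxN (M : 'M[R]_1) : (- M) 0 0 = - M 0 0 by rewrite mxE.
  have mxD (M N : 'M[R]_1) : (M + N) 0 0 = M 0 0 + N 0 0 by rewrite mxE.
  have wT : w^T = x^T - e^T by rewrite linearB.
  rewrite /c -frob_vecE wT /w !(mulmxBl, mulmxBr) !(mxD, mxN) !frob_vecE x1 ee.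
  by rewrite xeE; field.
exists (1%:M - (2 / c) *: (w *m w^T)); split.
- by rewrite linearB /= trmxZ trmx_mul trmxK trmx1.
- rewrite mulmxBl mul1mx mulmxBr mulmx1 -scalemxAl -scalemxAr scalerA.
  rewrite mulmxA -(mulmxA w) wwE mul_mx_scalar -scalemxAl scalerA.
  rewrite -addrA -opprD -scalerBl -scalerDl.
  have -> : 2 / c + (2 / c - 2 / c * (2 / c) * c) = 0 by field; rewrite gt_eqF.
  by rewrite scale0r subr0.
- rewrite mulmxBl mul1mx -scalemxAl -mulmxA we mul_mx_scalar scalerA.
  have -> : 2 / c * - (c / 2) = -1 by field; rewrite gt_eqF.
  by rewrite scaleN1r opprK addrC subrK.
Qed.

Theorem symmetric_spectral n (A : 'M[R]_n) : A^T = A ->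
  exists (U : 'M[R]_n) (a : 'rV[R]_n), U^T *m U = 1%:M /\ A = U *m diag_mx a *m U^T.
Proof.
elim: n A => [A _|n IH A As].
  by exists 1%:M, 0; split; apply/matrixP => -[].
have [l [x [x1 Ax]]] := symmetric_eigenvector As.
have [H [HT HH He]] := householder x1.
have [A' A'def] : exists A' : 'M[R]_(1 + n), A' = H *m A *m H by eexists.
have A's : A'^T = A' by rewrite A'def !trmx_mul HT As mulmxA.
(* The reflection moves the eigenvector to the first basis vector; together with symmetry this
   splits off a block of size 1. *)
have A'e : A' *m delta_mx 0 0 = l *: delta_mx 0 0 :> 'cV[R]_(1 + n).
  by rewrite A'def -!mulmxA He Ax -scalemxAr -He mulmxA HH mul1mx.
have A'col i : A' i 0 = l * (i == 0)%:R.
  by move/matrixP/(_ i 0): A'e; rewrite -colE !mxE eqxx andbT.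
have [|U [a [UU UA]]] := IH (drsubmx A').
  by rewrite -[RHS]/(drsubmx A') -{2}A's trmx_drsub.
have A'E : A' = block_mx l%:M 0 0 (U *m diag_mx a *m U^T).
  rewrite -UA -[LHS]submxK; congr block_mx.
  - by apply/matrixP => i j; rewrite !ord1 !mxE !lshift0 A'col eqxx mulr1 mulr1n.
  - apply/matrixP => i j; rewrite -A's !ord1 !mxE lshift0 A'col -val_eqE /=.
    by rewrite mulr0.
  - apply/matrixP => i j; rewrite !ord1 !mxE lshift0 A'col -val_eqE /=.
    by rewrite mulr0.
pose V : 'M[R]_(1 + n) := block_mx 1%:M 0 0 U.
have VV : V^T *m V = 1%:M.
  rewrite /V tr_block_mx mulmx_block !trmx0 !mulmx0 !mul0mx !addr0 !add0r.
  by rewrite trmx1 mulmx1 UU -scalar_mx_block.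
have VA : A' = V *m diag_mx (row_mx l%:M a) *m V^T.
  rewrite A'E /V diag_mx_row tr_block_mx !mulmx_block !trmx0 trmx1.
  rewrite !(mulmx0, mul0mx, addr0, add0r, mulmx1, mul1mx).
  by congr block_mx; apply/matrixP => i j; rewrite !ord1 !mxE.
exists (H *m V), (row_mx l%:M a : 'rV_(1 + n)); split.
  by rewrite trmx_mul HT -mulmxA (mulmxA H) HH mul1mx.
have -> : A = H *m A' *m H.
  by rewrite A'def -!mulmxA HH mulmx1 !mulmxA HH mul1mx.
by rewrite VA trmx_mul HT !mulmxA.
Qed.

End Spectral.

(** * Invariant forms of bounded semigroups *)

Section FrobeniusNorm.
Variable R : realType.

(** Lagrange's identity: the defect is half the sum of the squares
    [(a i * b j - a j * b i) ^+ 2]. *)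
Lemma sum_CauchySchwarz (I : finType) (a b : I -> R) :
  (\sum_i a i * b i) ^+ 2 <= (\sum_i a i ^+ 2) * (\sum_i b i ^+ 2).
Proof.
have : 0 <= \sum_i \sum_j (a i * b j - a j * b i) ^+ 2.
  by apply: sumr_ge0 => i _; apply: sumr_ge0 => j _; exact: sqr_ge0.
have -> : \sum_i \sum_j (a i * b j - a j * b i) ^+ 2 =
    2 * ((\sum_i a i ^+ 2) * (\sum_i b i ^+ 2) - (\sum_i a i * b i) ^+ 2).
  transitivity (\sum_i \sum_j ((a i ^+ 2 * b j ^+ 2 + a j ^+ 2 * b i ^+ 2) -
     2 * ((a i * b i) * (a j * b j)))).
    by apply: eq_bigr => i _; apply: eq_bigr => j _; ring.
  have E (u v : I -> R) : \sum_i \sum_j u i * v j = (\sum_i u i) * (\sum_i v i).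
    by rewrite mulr_suml; apply: eq_bigr => i _; rewrite mulr_sumr.
  under eq_bigr do rewrite sumrB big_split /= -[X in _ - X]mulr_sumr.
  rewrite sumrB big_split /= -[X in _ - X]mulr_sumr E (E (fun i => a i * b i)) exchange_big.
  by rewrite (E (fun i => a i ^+ 2) (fun i => b i ^+ 2)) /= expr2; ring.
by rewrite pmulr_rge0// subr_ge0.
Qed.

Lemma frobM m n p (A : 'M[R]_(m, n)) (B : 'M[R]_(n, p)) :
  frob (A *m B) <= frob A * frob B.
Proof.
rewrite {1}/frob.
apply: (@le_trans _ _ (\sum_i \sum_j (\sum_k A i k ^+ 2) * (\sum_k B k j ^+ 2))).
  apply: ler_sum => i _; apply: ler_sum => j _; rewrite mxE.
  exact: sum_CauchySchwarz.
rewrite /frob [X in _ * X]exchange_big /= mulr_suml le_eqVlt; apply/orP; left.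
by apply/eqP; apply: eq_bigr => i _; rewrite mulr_sumr.
Qed.

Lemma frob_tr m n (A : 'M[R]_(m, n)) : frob A^T = frob A.
Proof.
by rewrite /frob exchange_big; apply: eq_bigr => i _; apply: eq_bigr => j _; rewrite mxE.
Qed.

Lemma frobZ m n k (A : 'M[R]_(m, n)) : frob (k *: A) = k ^+ 2 * frob A.
Proof. by rewrite !frobE trmxZ -scalemxAl -scalemxAr scalerA mxtraceZ expr2. Qed.

Lemma frob_parallelogram m n (A B : 'M[R]_(m, n)) :
  frob (A + B) + frob (A - B) = 2 * (frob A + frob B).
Proof.
rewrite /frob -!big_split mulr_sumr; apply: eq_bigr => i _ /=.
rewrite -!big_split mulr_sumr; apply: eq_bigr => j _ /=.
by rewrite !mxE; ring.
Qed.

Lemma mx_norm_frob m n (A : 'M[R]_(m, n)) : `|A| ^+ 2 <= frob A.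
Proof.
have f0 := frob_ge0 A.
rewrite -[leRHS]sqr_sqrtr// ler_pXn2r ?nnegrE//; apply: mx_norm_le => // i j.
by rewrite -(@ler_pXn2r _ 2)// ?nnegrE// sqr_sqrtr// real_normK ?num_real// frob_entry.
Qed.

Lemma compact_frob m n (A : set 'M[R]_(m, n)) c :
  closed A -> (forall M, A M -> frob M <= c) -> compact A.
Proof.
move=> clA Ac; apply: (@compact_mx _ _ _ _ (Num.sqrt c)) => // M AM.
have c0 : 0 <= c by rewrite (le_trans (frob_ge0 M))// Ac.
by rewrite -(@ler_pXn2r _ 2)// ?nnegrE// sqr_sqrtr// (le_trans (mx_norm_frob M))// Ac.
Qed.

(** When the determinant is 1 or -1 the inverse has the norm of the adjugate, and the adjugate is
    continuous on a compact ball. *)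
Lemma frob_inv_bound n c : exists2 e : R, 0 < e &
  forall k : 'M[R]_n, `|\det k| = 1 -> frob k <= c -> frob (invmx k) <= e.
Proof.
pose A := [set k : 'M[R]_n | frob k <= c].
have cid : continuous (fun k : 'M[R]_n => k) by move=> x; exact: cvg_id.
have cA : compact A.
  apply: (@compact_frob _ _ _ c) => //.
  by apply: closed_preimage_le; exact: continuous_frob.
pose f (k : 'M[R]_n) := - frob (\adj k).
have cf : continuous f.
  by apply: continuous_opp; apply: continuous_frob; exact: continuous_adjmx.
have [A0|/set0P/negP/negPn/eqP A0] := pselect (A !=set0); last first.
  by exists 1 => // k _ kc; have : A k by []; rewrite A0.
have [k0 _ k0min] := compact_argmin A0 cA cf.
exists (frob (\adj k0) + 1); first by rewrite ltr_wpDl// frob_ge0.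
move=> k k1 kc; have ku : k \in unitmx.
  by rewrite unitmxE unitfE -normr_eq0 k1 oner_eq0.
rewrite /invmx ku frobZ exprVn -[X in X^-1]real_normK ?num_real// k1 expr1n invr1 mul1r.
by have := k0min _ kc; rewrite /f lerN2 => /le_trans; apply; rewrite lerDl.
Qed.

(* Points are minimised over pairs (Q, t) with t a bound for the whole orbit of
   Q; strict convexity makes the minimiser fixed by K. *)
Lemma bounded_semigroup_invariant_form n (K : set 'M[R]_n) c :
  (forall k, K k -> `|\det k| = 1) -> (forall k, K k -> frob k <= c) ->
  (forall k h, K k -> K h -> K (k *m h)) ->
  exists Q : 'M[R]_n,
    (forall x : 'cV[R]_n, frob x <= (x^T *m Q *m x) 0 0) /\
    forall k, K k -> k^T *m Q *m k = Q.
Proof.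
(* Adjoining the identity makes the conditions of [X] below bear on [Q] itself, not only on its
   translates. *)
move=> K1 Kc KM; pose L k := K k \/ k = 1%:M.
have LM k h : L k -> L h -> L (k *m h).
  move=> [Kk|->]; last by rewrite mul1mx.
  by move=> [Kh|->]; [left; exact: KM|rewrite mulmx1; left].
have [e e0 Le] : exists2 e, 0 < e & forall k, L k -> frob (invmx k) <= e.
  have [e e0 He] := frob_inv_bound n (Num.max c (frob (1%:M : 'M[R]_n))).
  exists e => // k Lk; apply: He.
    by case: Lk => [/K1//|->]; rewrite det1 normr1.
  by case: Lk => [/Kc kc|->]; rewrite le_max ?kc// lexx orbT.
have Lu k : L k -> k \in unitmx.
  case=> [/K1 k1|->]; last exact: unitmx1.
  by rewrite unitmxE unitfE -normr_eq0 k1 oner_eq0.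
have frob_conj k (D : 'M[R]_n) : L k -> frob D <= e ^+ 2 * frob (k^T *m D *m k).
  move=> Lk; have ku := Lu _ Lk.
  have -> : frob D = frob ((invmx k)^T *m (k^T *m D *m k) *m invmx k).
    by rewrite mulmxA -mulmxA mulmxV// mulmx1 mulmxA -trmx_mul mulmxV// trmx1 mul1mx.
  apply: le_trans (frobM _ _) _; set M := k^T *m D *m k.
  have -> : e ^+ 2 * frob M = (e * frob M) * e by ring.
  rewrite ler_pM ?frob_ge0 ?Le//.
  by rewrite (le_trans (frobM _ _))// frob_tr ler_wpM2r ?frob_ge0// Le.
have frob_lin k (x : 'cV[R]_n) : L k -> frob x <= e * frob (k *m x).
  move=> Lk; rewrite -{1}[x](mulKmx (Lu _ Lk)) (le_trans (frobM _ _))//.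
  by rewrite ler_wpM2r ?frob_ge0// Le.
(* The first condition keeps the form uniformly definite along the orbit, the second one bounds the
   orbit by [t]. *)
pose X (Qt : 'M[R]_n * R) := forall k, L k ->
  (forall x : 'cV[R]_n, frob x <= ((k *m x)^T *m Qt.1 *m (k *m x)) 0 0) /\
  frob (k^T *m Qt.1 *m k) <= Qt.2.
have [c' Lc] : exists c', forall k, L k -> frob k <= c'.
  exists (Num.max c (frob (1%:M : 'M[R]_n))) => k.
  by case=> [/Kc kc|->]; rewrite le_max ?kc// lexx orbT.
have c'0 : 0 <= c' by rewrite (le_trans (frob_ge0 (1%:M : 'M[R]_n)))// Lc//; right.
pose t0 := c' * frob (e%:M : 'M[R]_n) * c'.
have X0 : X (e%:M, t0).
  move=> k Lk; split=> /= [x|].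
    by rewrite mul_mx_scalar -scalemxAl mxE frob_vecE frob_lin.
  rewrite (le_trans (frobM _ _))// ler_pM ?frob_ge0 ?Lc//.
  by rewrite (le_trans (frobM _ _))// frob_tr ler_wpM2r ?frob_ge0 ?Lc.
have clX : closed X.
  have c1 : continuous (fun Qt : 'M[R]_n * R => Qt.1).
    by move=> z; exact: cvg_fst.
  have c2 : continuous (fun Qt : 'M[R]_n * R => Qt.2).
    by move=> z; exact: cvg_snd.
  have cc m p (A : 'M[R]_(m, p)) : continuous (fun Qt : 'M[R]_n * R => A).
    exact: cst_continuous.
  apply: closed_forall => k; apply: closed_imply => Lk; apply: closedI.
    apply: closed_forall => x; apply: closed_preimage_ge.
    by apply: continuous_entry; do 2?apply: continuous_mulmx => //.
  rewrite [X in closed X](_ : _ =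
    [set Qt : 'M[R]_n * R | frob (k^T *m Qt.1 *m k) - Qt.2 <= 0]).
    apply: closed_preimage_le; apply: continuous_add.
      by apply: continuous_frob; do 2?apply: continuous_mulmx => //.
    exact: continuous_opp.
  by apply/seteqP; split=> Qt /=; rewrite subr_le0.
have X1 Qt : X Qt -> frob Qt.1 <= Qt.2.
  by move=> /(_ 1%:M (or_intror erefl)) [_]; rewrite trmx1 mul1mx mulmx1.
pose Y := ([set Q : 'M[R]_n | frob Q <= t0] `*` `[0, t0]) `&` X.
have cY : compact Y.
  apply: compact_closedI => //; apply: compact_setX; last exact: segment_compact.
  apply: (@compact_frob _ _ _ t0) => //.
  by apply: closed_preimage_le; apply: continuous_frob => z; exact: cvg_id.
have YP Qt : X Qt -> Qt.2 <= t0 -> Y Qt.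
  move=> XQt Qt0; split => //; split; first exact: le_trans (X1 _ XQt) Qt0.
  by rewrite /= in_itv /= Qt0 (le_trans _ (X1 _ XQt))// frob_ge0.
have [||[Q t] [[_]]] := @compact_argmin R _ snd Y _ cY.
- by exists (e%:M, t0); exact: YP.
- by move=> z; exact: cvg_snd.
rewrite /= in_itv /= => /andP [_ tt0] XQ tmin.
exists Q; split=> [x|k Kk].
  by have [+ _] := XQ _ (or_intror erefl) => /(_ x); rewrite /= mul1mx.
have Lk : L k by left.
have XQ' : X (k^T *m Q *m k, t).
  move=> h Lh; have [H1 H2] := XQ _ (LM _ _ Lk Lh); split=> [x|] /=.
    by move: (H1 x); rewrite /= !trmx_mul !mulmxA.
  by move: H2; rewrite /= trmx_mul !mulmxA.
set Q' := k^T *m Q *m k in XQ' *.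
(* By the parallelogram identity, the midpoint of [Q] and [Q'] gains a quarter of the squared
   distance of their translates, and [frob_conj] compares this distance with [frob (Q - Q')] at the
   cost of [e ^+ 2]. *)
pose eta := (4 * e ^+ 2)^-1.
have eta0 : 0 < eta by rewrite invr_gt0 mulr_gt0// exprn_gt0.
have Xmid : X (2^-1 *: (Q + Q'), t - eta * frob (Q - Q')).
  move=> h Lh; have [H1 H2] := XQ _ Lh; have [H1' H2'] := XQ' _ Lh; split=> [x|] /=.
    rewrite -scalemxAr -scalemxAl mulmxDr mulmxDl [leRHS]mxE [X in _ * X]mxE.
    move: (H1 x) (H1' x) => /=; lra.
  rewrite -scalemxAr -scalemxAl mulmxDr mulmxDl frobZ.
  move: H2 H2' (frob_conj _ (Q - Q') Lh) => /= H2 H2'.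
  rewrite mulmxBr mulmxBl.
  move: (frob_parallelogram (h^T *m Q *m h) (h^T *m Q' *m h)) => par.
  set F := frob (_ - _) => He.
  have : eta * F <= 4^-1 * frob (h^T *m Q *m h - h^T *m Q' *m h).
    rewrite /eta invfM -mulrA ler_wpM2l ?invr_ge0// ler_pdivrMl ?exprn_gt0//.
  move: par H2 H2'; lra.
have F0 := frob_ge0 (Q - Q').
have Ft : t - eta * frob (Q - Q') <= t0.
  by rewrite lerBlDr (le_trans tt0)// lerDl mulr_ge0// ltW.
have := tmin _ (YP _ Xmid Ft); rewrite /= lerBrDr gerDl pmulr_rle0// => F0'.
have /frob_eq0/eqP : frob (Q - Q') = 0 by apply/eqP; rewrite eq_le F0 F0'.
by rewrite subr_eq0 => /eqP.
Qed.

Lemma det_mx0 n : (0 < n)%N -> \det (0 : 'M[R]_n) = 0.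
Proof. by case: n => // n _; rewrite det0. Qed.

(** On the unit sphere of the cone [N] the determinant is bounded away from 0 by compactness, and
    homogeneity carries the bound to the matrices of determinant 1 or -1. This serves both the
    corners and the properness of conjugation. *)
Lemma cone_det_bound n (N : 'M[R]_n -> Prop) : (0 < n)%N ->
  compact [set X | frob X = 1 /\ N X] -> (forall l X, N X -> N (l *: X)) ->
  (forall X, N X -> X != 0 -> \det X != 0) ->
  exists2 c : R, 0 <= c & forall X, N X -> `|\det X| = 1 -> frob X <= c.
Proof.
move=> n0 cN NZ Ndet; set A := [set X | _] in cN.
have AN Z : N Z -> `|\det Z| = 1 -> 0 < frob Z /\ A ((Num.sqrt (frob Z))^-1 *: Z).
  move=> NZ' dZ; have Z0 : Z != 0.
    by apply/eqP => Z0; move/eqP: dZ; rewrite Z0 det_mx0// normr0 eq_sym oner_eq0.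
  have fZ := frob_gt0 Z0; split=> //; split; last exact: NZ.
  by rewrite frobZ exprVn sqr_sqrtr ?mulVf ?gt_eqF// ltW.
have [A0|/set0P/negP/negPn/eqP A0] := pselect (A !=set0); last first.
  by exists 0 => // X NX dX; have [_] := AN _ NX dX; rewrite A0.
pose f (X : 'M[R]_n) := \det X * \det X.
have cf : continuous f.
  by apply: continuous_mul; apply: continuous_det => x; exact: cvg_id.
have [X0 [X01 NX0] X0min] := compact_argmin A0 cN cf.
have D0 : 0 < f X0.
  rewrite /f -expr2 exprn_even_gt0//=; apply: Ndet => //.
  by apply/eqP => X00; move/eqP: X01; rewrite X00 frobE mulmx0 mxtrace0 eq_sym oner_eq0.
(* Homogeneity gives [frob X ^+ n <= (f X0)^-1]; the 1 covers the case [frob X <= 1], where the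
   power does not dominate [frob X]. *)
exists (Num.max 1 (f X0)^-1); first by rewrite le_max ler01.
move=> Z NZ' dZ; have [fZ AZ] := AN _ NZ' dZ.
have := X0min _ AZ; rewrite {2}/f detZ -expr2 exprMn -[X in _ * X]real_normK ?num_real//.
rewrite dZ expr1n mulr1 -exprM mulnC exprM exprVn sqr_sqrtr ?(ltW fZ)// exprVn => H.
rewrite le_max; case: (leP (frob Z) 1) => //= Z1.
apply: (le_trans (ler_eXnr n0 (ltW Z1))).
by rewrite -[leLHS]invrK lef_pV2 ?posrE ?invr_gt0 ?exprn_gt0.
Qed.

End FrobeniusNorm.

(** * Corners of rank-minimal elements *)

Section PolynomialFunctions.
Variables (R : realType) (d : nat).

Definition polynomial_fun (F : 'M[R]_d -> R) :=
  exists f : mx_poly R d, forall g, mx_poly_eval f g = F g.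

Lemma polynomial_cst c : polynomial_fun (fun=> c).
Proof. by exists (mpoly.mpolyC _ c) => g; exact: mpoly.mevalC. Qed.

Lemma polynomial_entry i j : polynomial_fun (fun g => g i j).
Proof.
exists (mpoly.mpolyX R (mpoly.mnm1 (mxvec_index i j))) => g.
by rewrite /mx_poly_eval mpoly.mevalXU mxvecE.
Qed.

Lemma polynomial_add F G : polynomial_fun F -> polynomial_fun G ->
  polynomial_fun (fun g => F g + G g).
Proof.
by move=> [f fF] [h hG]; exists ((f : mpoly.mpoly (d * d) R) + (h : mpoly.mpoly (d * d) R)) => g; rewrite /mx_poly_eval mpoly.mevalD
  -fF -hG.
Qed.

Lemma polynomial_mul F G : polynomial_fun F -> polynomial_fun G ->
  polynomial_fun (fun g => F g * G g).
Proof.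
by move=> [f fF] [h hG]; exists ((f : mpoly.mpoly (d * d) R) * (h : mpoly.mpoly (d * d) R)) => g; rewrite /mx_poly_eval mpoly.mevalM
  -fF -hG.
Qed.

Lemma polynomial_ext F G : F =1 G -> polynomial_fun F -> polynomial_fun G.
Proof. by move=> FG [f fF]; exists f => g; rewrite fF. Qed.

Lemma polynomial_sum (I : Type) (s : seq I) (P : pred I) (F : I -> 'M[R]_d -> R) :
  (forall i, polynomial_fun (F i)) ->
  polynomial_fun (fun g => \sum_(i <- s | P i) F i g).
Proof.
move=> pF; elim: s => [|i s IH].
  by apply: (polynomial_ext _ (polynomial_cst 0)) => g /=; rewrite big_nil.
apply: (@polynomial_ext (fun g => (if P i then F i g else 0) + \sum_(j <- s | P j) F j g)).
  by move=> g; rewrite big_cons; case: (P i) => //=; exact: add0r.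
by apply: polynomial_add => //; case: (P i) => //; exact: polynomial_cst.
Qed.

Lemma polynomial_prod (I : Type) (s : seq I) (P : pred I) (F : I -> 'M[R]_d -> R) :
  (forall i, polynomial_fun (F i)) ->
  polynomial_fun (fun g => \prod_(i <- s | P i) F i g).
Proof.
move=> pF; elim: s => [|i s IH].
  by apply: (polynomial_ext _ (polynomial_cst 1)) => g /=; rewrite big_nil.
apply: (@polynomial_ext (fun g => (if P i then F i g else 1) * \prod_(j <- s | P j) F j g)).
  by move=> g; rewrite big_cons; case: (P i) => //=; exact: mul1r.
by apply: polynomial_mul => //; case: (P i) => //; exact: polynomial_cst.
Qed.

Definition polynomial_mx m n (F : 'M[R]_d -> 'M[R]_(m, n)) :=
  forall i j, polynomial_fun (fun g => F g i j).

Lemma polynomial_mx_id : polynomial_mx id.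
Proof. exact: polynomial_entry. Qed.

Lemma polynomial_mx_cst m n (A : 'M[R]_(m, n)) : polynomial_mx (fun=> A).
Proof. by move=> i j; exact: polynomial_cst. Qed.

Lemma polynomial_mx_mul m n p (F : 'M[R]_d -> 'M[R]_(m, n)) (G : 'M[R]_d -> 'M[R]_(n, p)) :
  polynomial_mx F -> polynomial_mx G -> polynomial_mx (fun g => F g *m G g).
Proof.
move=> pF pG i j; apply: (@polynomial_ext (fun g => \sum_k F g i k * G g k j)).
  by move=> g; rewrite mxE.
by apply: polynomial_sum => k; exact: polynomial_mul.
Qed.

Lemma polynomial_mx_tr m n (F : 'M[R]_d -> 'M[R]_(m, n)) :
  polynomial_mx F -> polynomial_mx (fun g => (F g)^T).
Proof. by move=> pF i j; apply: (polynomial_ext _ (pF j i)) => g; rewrite mxE. Qed.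

Lemma polynomial_det n (F : 'M[R]_d -> 'M[R]_n) :
  polynomial_mx F -> polynomial_fun (fun g => \det (F g)).
Proof.
move=> pF; apply: polynomial_sum => s; apply: polynomial_mul.
  exact: polynomial_cst.
by apply: polynomial_prod => i; exact: pF.
Qed.

Lemma zariski_sub (S : set 'M[R]_d) : subsemigroup_GL S -> S `<=` zariski_closure_GL S.
Proof. by move=> [_ Su _] g Sg; split; [exact: Su|move=> f; exact]. Qed.

(** A polynomial vanishing on [S] vanishes on its Zariski closure; homogeneity extends this to the
    multiples and continuity to their limits. *)
Lemma zariski_cone_vanish (S : set 'M[R]_d) F n : polynomial_fun F -> continuous F ->
  (forall l g, F (l *: g) = l ^+ n * F g) -> (forall g, S g -> F g = 0) ->
  forall p, real_cone_closure (zariski_closure_GL S) p -> F p = 0.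
Proof.
move=> [f fF] cF FZ FS; apply: cone_closure_min.
  exact: closed_preimage_eq.
move=> l g [_ Zg] /=; rewrite FZ -fF Zg ?mulr0// => h /FS.
by rewrite fF.
Qed.

End PolynomialFunctions.

(** * Rank factorizations *)

Section RankFactorization.
Variable K : fieldType.

Lemma rank_factorization m n r (p : 'M[K]_(m, n)) : \rank p = r ->
  exists (B : 'M[K]_(m, r)) (C : 'M[K]_(r, n)),
    [/\ p = B *m C, \rank B = r & \rank C = r].
Proof.
move=> <-; exists (col_base p), (row_base p); split.
- by rewrite mulmx_base.
- exact/eqP/col_base_full.
- exact/eqP/row_base_free.
Qed.

Lemma full_col_linv m r (B : 'M[K]_(m, r)) : \rank B = r ->
  exists B' : 'M[K]_(r, m), B' *m B = 1%:M.
Proof. by move=> rB; apply/row_fullP; rewrite /row_full rB. Qed.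

Lemma full_row_rinv n r (C : 'M[K]_(r, n)) : \rank C = r ->
  exists C' : 'M[K]_(n, r), C *m C' = 1%:M.
Proof. by move=> rC; apply/row_freeP; rewrite /row_free rC. Qed.

Lemma mxrank_mul_full m n r (B : 'M[K]_(m, r)) (X : 'M[K]_r) (C : 'M[K]_(r, n)) :
  \rank B = r -> \rank C = r -> \rank (B *m X *m C) = \rank X.
Proof.
move=> /full_col_linv [B' B'B] /full_row_rinv [C' CC'].
apply/eqP; rewrite eqn_leq (leq_trans (mxrankM_maxl _ _))//=; last exact: mxrankM_maxr.
have {1}-> : X = B' *m (B *m X *m C) *m C'.
  by rewrite !mulmxA B'B mul1mx -mulmxA CC' mulmx1.
by rewrite (leq_trans (mxrankM_maxl _ _))// mxrankM_maxr.
Qed.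

Lemma det_neq0_rank n (X : 'M[K]_n) : (\det X != 0) = (\rank X == n).
Proof. by rewrite -unitfE -unitmxE -row_free_unit. Qed.

End RankFactorization.

(** * Corners as similarities of a definite form *)

Section Similarity.
Variables (R : realType) (d r : nat) (S : set 'M[R]_d).
Hypothesis (r_gt0 : (0 < r)%N).
Hypothesis SM : forall g h, S g -> S h -> S (g *m h).
Hypothesis rmin : forall p, real_cone_closure S p -> p != 0 -> (r <= \rank p)%N.
Variables (B : 'M[R]_(d, r)) (C : 'M[R]_(r, d)).
Hypotheses (SBC : real_cone_closure S (B *m C)) (rB : \rank B = r) (rC : \rank C = r).

(** The rank of [B *m X *m C] is that of [X], and no nonzero element of the cone closure has rank
    below [r]. *)
Lemma corner_det_neq0 X : real_cone_closure S (B *m X *m C) -> X != 0 -> \det X != 0.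
Proof.
move=> SX X0; rewrite det_neq0_rank eqn_leq rank_leq_row -(mxrank_mul_full X rB rC) rmin//.
by rewrite -mxrank_eq0 mxrank_mul_full// mxrank_eq0.
Qed.

Lemma corner_det_bound : exists2 c : R, 0 <= c &
  forall X, real_cone_closure S (B *m X *m C) -> `|\det X| = 1 -> frob X <= c.
Proof.
have cid : continuous (fun X : 'M[R]_r => X) by move=> x; exact: cvg_id.
apply: (cone_det_bound r_gt0) => [|l X SX|X]; last exact: corner_det_neq0; last first.
  by rewrite -scalemxAr -scalemxAl; exact: cone_closureZ.
apply: (@compact_closedI _ [set X | frob X = 1] [set X | real_cone_closure S (B *m X *m C)]).
  apply: (@compact_frob _ _ _ _ 1) => [|X /= ->//].
  by apply: closed_preimage_eq; exact: continuous_frob.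
apply: (@closed_preimage _ _ (fun X : 'M[R]_r => B *m X *m C) _ _ (@closed_cone_closure _ _ S)).
apply: continuous_mulmx; last exact: cst_continuous.
by apply: continuous_mulmx; first exact: cst_continuous.
Qed.

(** Since [B *m C] is in the cone closure, a product of corners is again a corner. Those of
    determinant 1 or -1 thus form a bounded semigroup with an invariant form, and any other nonzero
    corner is a multiple of one of them. *)
Lemma corner_similarity : exists Q : 'M[R]_r,
  (forall x : 'cV[R]_r, frob x <= (x^T *m Q *m x) 0 0) /\
  forall p, real_cone_closure S p ->
    exists mu, (C *m p *m B)^T *m Q *m (C *m p *m B) = mu *: Q.
Proof.
have [c c0 Hc] := corner_det_bound.
pose K (k : 'M[R]_r) := `|\det k| = 1 /\
  exists2 p, real_cone_closure S p & k = C *m p *m B.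
have cornerM p : real_cone_closure S p -> real_cone_closure S (B *m (C *m p *m B) *m C).
  move=> Sp; rewrite !mulmxA -(mulmxA _ B); exact: (cone_closureM SM (cone_closureM SM SBC Sp) SBC).
have [Q [Qpos QK]] : exists Q : 'M[R]_r,
    (forall x : 'cV[R]_r, frob x <= (x^T *m Q *m x) 0 0) /\
    forall k, K k -> k^T *m Q *m k = Q.
  apply: (@bounded_semigroup_invariant_form R r K c) => [k []//|k [k1 [p Sp kE]]|].
    by apply: Hc k1; rewrite kE; exact: cornerM Sp.
  move=> k h [k1 [p Sp kE]] [h1 [q Sq hE]]; split.
    by rewrite det_mulmx normrM k1 h1 mulr1.
  exists (p *m (B *m C) *m q); last by rewrite kE hE !mulmxA.
  exact: (cone_closureM SM (cone_closureM SM Sp SBC) Sq).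
exists Q; split=> // p Sp; set X := C *m p *m B.
have [->|X0] := eqVneq X 0; first by exists 0; rewrite mulmx0 scale0r.
have dX := corner_det_neq0 (cornerM _ Sp) X0.
(* The exponent normalises the determinant of the [r] by [r] matrix [s *: X] to absolute value 1. *)
pose s := `|\det X| `^ (- r%:R^-1).
have sr : s ^+ r = `|\det X|^-1.
  rewrite -powR_mulrn ?powR_ge0// -powRrM mulNr mulVf ?pnatr_eq0 ?lt0n_neq0//.
  by rewrite powR_inv1.
have s0 : s != 0 by rewrite gt_eqF// powR_gt0// normr_gt0.
have /QK : K (s *: X).
  split; first by rewrite detZ normrM sr normfV normr_id mulVf ?normr_eq0.
  exists (s *: p); first exact: cone_closureZ.
  by rewrite -scalemxAr -scalemxAl.
rewrite trmxZ -scalemxAr -!scalemxAl scalerA => H.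
by exists (s * s)^-1; rewrite -[in RHS]H scalerA mulVf ?scale1r// mulf_neq0.
Qed.

End Similarity.

(** * Transversality and the Zariski closure *)

Section PropertyS.
Variables (R : realType) (d : nat).
Implicit Types (S : set 'M[R]_d).

(** [L] stands for its kernel [W], of codimension [r]: the last condition says that the image of [p]
    meets [W] trivially. *)
Definition left_transversal S r := forall L : 'M[R]_(r, d), \rank L = r ->
  exists p, [/\ real_cone_closure S p, \rank p = r & \rank (L *m p) = r].

(** [V] stands for its column space, which the last condition makes transversal to the kernel of
    [p]. *)
Definition right_transversal S r := forall V : 'M[R]_(d, r), \rank V = r ->
  exists p, [/\ real_cone_closure S p, \rank p = r & \rank (p *m V) = r].

Lemma proximal_dim_min S : subsemigroup_GL S -> (0 < d)%N ->
  [/\ (0 < proximal_dim S)%N,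
      exists2 p, real_cone_closure S p & \rank p = proximal_dim S
    & forall p, real_cone_closure S p -> p != 0 -> (proximal_dim S <= \rank p)%N].
Proof.
move=> SS d0; have [[p [Sp /= p0] pr] rmin] := proximal_dimP (proximal_ranks_neq0 SS d0).
split; last by move=> q Sq /eqP q0; apply: rmin; exists q.
  by rewrite -pr lt0n mxrank_eq0; exact/eqP.
by exists p.
Qed.

Section Zariski.
Variables (S : set 'M[R]_d) (r : nat).
Hypotheses (SS : subsemigroup_GL S) (irrS : bi_irreducible S) (r_gt0 : (0 < r)%N).
Hypothesis rmin : forall p, real_cone_closure S p -> p != 0 -> (r <= \rank p)%N.
Variables (B : 'M[R]_(d, r)) (C : 'M[R]_(r, d)).
Hypotheses (SBC : real_cone_closure S (B *m C)) (rB : \rank B = r) (rC : \rank C = r).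
Let G := zariski_closure_GL S.

Let SM g h : S g -> S h -> S (g *m h).
Proof. by case: SS => _ _; exact. Qed.

(* Being a similarity of Q is a polynomial condition, so that it passes from S to
   its Zariski closure; a nonzero similarity is invertible. *)
Lemma zariski_corner p : real_cone_closure G p -> p != 0 ->
  exists g h, [/\ S g, S h & \det (C *m g *m p *m h *m B) != 0].
Proof.
move=> Gp p0; have [Q [Qpos QS]] := corner_similarity r_gt0 SM rmin SBC rB rC.
have C0 : C != 0 by rewrite -mxrank_eq0 rC -lt0n.
have B0 : B != 0 by rewrite -mxrank_eq0 rB -lt0n.
(* Irreducibility, used on both sides of [p], makes the corner of [g *m p *m h] nonzero. *)
have [g Sg Cgp] := irrS C0 p0; have [h Sh X0] := irrS Cgp B0.
exists g, h; split=> //; set X := _ *m B in X0 *.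
pose Y p' := C *m g *m p' *m h *m B; pose Z p' := (Y p')^T *m Q *m Y p'.
have pZ : polynomial_mx Z.
  have pY : polynomial_mx Y.
    do 2?[apply: polynomial_mx_mul; last exact: polynomial_mx_cst].
    by apply: polynomial_mx_mul; [exact: polynomial_mx_cst|exact: polynomial_mx_id].
  apply: polynomial_mx_mul => //.
  by apply: polynomial_mx_mul; [exact: polynomial_mx_tr|exact: polynomial_mx_cst].
have cZ : continuous Z.
  have cY : continuous Y.
    do 2?[apply: continuous_mulmx; last exact: cst_continuous].
    by apply: continuous_mulmx; [exact: cst_continuous|move=> x; exact: cvg_id].
  apply: (continuous_mulmx _ cY).
  by apply: continuous_mulmx; [exact: (continuous_trmx cY)|exact: cst_continuous].
have ZZ l p' : Z (l *: p') = l ^+ 2 *: Z p'.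
  have YZ : Y (l *: p') = l *: Y p' by rewrite /Y -scalemxAr -!scalemxAl.
  by rewrite /Z YZ trmxZ -scalemxAr -!scalemxAl scalerA expr2.
(* Proportionality to [Q] is written through vanishing 2 by 2 minors, so as to be polynomial and
   homogeneous of degree 2 in the matrix, without the unknown factor. *)
have QZ i j k l : Z p i j * Q k l + - Q i j * Z p k l = 0.
  pose F p' := Z p' i j * Q k l + - Q i j * Z p' k l.
  apply: (@zariski_cone_vanish _ _ S F 2) Gp => [||a q|q Sq].
  - by apply: polynomial_add; apply: polynomial_mul => //; exact: polynomial_cst.
  - by apply: continuous_add; apply: continuous_mul; rewrite ?cst_continuous//;
      do ?[exact: continuous_entry|exact: cst_continuous].
  - by rewrite /F ZZ !mxE; ring.
  - have [|mu muE] := QS (g *m q *m h).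
      by apply: cone_closure_sub; do 2?apply: SM.
    rewrite /F /Z (_ : Y q = C *m (g *m q *m h) *m B) ?muE ?mxE; last by rewrite !mulmxA.
    by ring.
have XE : Y p = X by []. clearbody X.
apply/negP => /det0P [v v0 vX].
have [w w0 Xw] : exists2 w : 'cV[R]_r, w != 0 & X *m w = 0.
  have /det0P [w w0 wX] : \det X^T == 0 by rewrite det_tr; apply/det0P; exists v.
  by exists w^T; rewrite ?trmx_eq0//; apply: trmx_inj; rewrite trmx_mul trmxK wX trmx0.
have [i [j Qij]] : exists i j, Q i j != 0.
  apply: contrapT => Q0; have Qz : Q = 0.
    apply/matrixP => i j; rewrite mxE; apply/eqP; apply: contrapT => /negP Qij.
    by apply: Q0; exists i, j.
  by have := Qpos w; rewrite Qz mulmx0 mul0mx mxE leNgt frob_gt0.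
have [mu ZQ] : exists mu, Z p = mu *: Q.
  exists (Z p i j / Q i j); apply/matrixP => k l; rewrite [RHS]mxE; apply: (mulIf Qij).
  rewrite mulrAC divfK//; apply/eqP; rewrite -subr_eq0 -oppr_eq0 opprB.
  by rewrite -(QZ i j k l) mulNr [X in _ - X]mulrC eqxx.
case/eqP: X0.
(* A null vector of [X] forces the similarity factor to be 0, and definiteness of [Q] then kills
   every column of [X]. *)
have mu0 : mu = 0.
  have : (w^T *m Z p *m w) 0 0 = 0 by rewrite /Z XE -!mulmxA Xw !mulmx0 mxE.
  rewrite ZQ -scalemxAr -scalemxAl mxE => /eqP; rewrite mulf_eq0 => /orP[/eqP//|].
  by rewrite gt_eqF// (lt_le_trans (frob_gt0 w0)).
apply/matrixP => a b; rewrite [RHS]mxE.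
pose e : 'cV[R]_r := delta_mx b 0.
have Xe : X *m e = 0.
  apply: frob_eq0; apply/eqP; rewrite eq_le frob_ge0 andbT.
  apply: (le_trans (Qpos _)).
  rewrite trmx_mul -XE.
  have -> : e^T *m (Y p)^T *m Q *m (Y p *m e) = e^T *m Z p *m e by rewrite /Z !mulmxA.
  by rewrite ZQ mu0 scale0r mulmx0 mul0mx mxE.
by move/matrixP/(_ a 0): Xe; rewrite -colE !mxE.
Qed.

Lemma zariski_rank_min p : real_cone_closure G p -> p != 0 -> (r <= \rank p)%N.
Proof.
move=> Gp p0; have [g [h [_ _]]] := zariski_corner Gp p0.
rewrite det_neq0_rank => /eqP <-.
by rewrite (leq_trans (mxrankM_maxl _ _))// (leq_trans (mxrankM_maxl _ _))// mxrankM_maxr.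
Qed.

(** If [L] defeats the cone closure of [S], it defeats all [g *m B *m C], so
    [\det (L *m q *m h *m B)] vanishes for [q] in [S] and hence in the cone closure of [G]. At an
    element [p0 = B0 *m C0] transversal to [L] it factors into two nonzero determinants, the second
    one by the choice of [h] in [zariski_corner]. *)
Lemma zariski_left_transversal : left_transversal S r <-> left_transversal G r.
Proof.
split=> LT L rL.
  have [p [Sp rp rLp]] := LT _ rL; exists p; split=> //.
  by apply: cone_closure_mono Sp; exact: zariski_sub.
apply: contrapT => nLT.
have detS g : S g -> \det (L *m g *m B) = 0.
  move=> Sg; apply/eqP; apply: contrapT => /negP; rewrite det_neq0_rank => /eqP rk.
  have gu : g \in unitmx by case: SS => _ + _; exact.
  apply: nLT; exists (g *m B *m C); split.
  - rewrite -mulmxA; apply: cone_closureM => //; exact: cone_closure_sub.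
  - have rg : \rank (g *m B) = r by rewrite (eqmxMfull _ _) ?rB// row_full_unit.
    by rewrite -[X in X *m C]mulmx1 mxrank_mul_full// mxrank1.
  - rewrite !mulmxA -[L *m g *m B]mul1mx mxrank_mul_full// ?mxrank1//.
have [p0 [Gp0 rp0 rLp0]] := LT _ rL.
have [B0 [C0 [p0E rB0 rC0]]] := rank_factorization rp0.
have [|g [h [_ Sh]]] := zariski_corner Gp0.
  by rewrite -mxrank_eq0 rp0 -lt0n.
have -> : C *m g *m p0 *m h *m B = (C *m g *m B0) *m (C0 *m h *m B).
  by rewrite p0E !mulmxA.
rewrite det_mulmx mulf_eq0 negb_or => /andP[_ C0hB].
have LB0 : \det (L *m B0) != 0.
  rewrite det_neq0_rank eqn_leq rank_leq_row /= -[X in (X <= _)%N]rLp0 p0E mulmxA.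
  exact: mxrankM_maxl.
have : \det (L *m p0 *m h *m B) = 0.
  apply: (@zariski_cone_vanish _ _ S (fun q => \det (L *m q *m h *m B)) r) Gp0.
  - apply: polynomial_det; do 2?[apply: polynomial_mx_mul; last exact: polynomial_mx_cst].
    by apply: polynomial_mx_mul; [exact: polynomial_mx_cst|exact: polynomial_mx_id].
  - apply: continuous_det; do 2?[apply: continuous_mulmx; last exact: cst_continuous].
    by apply: continuous_mulmx; [exact: cst_continuous|move=> x; exact: cvg_id].
  - by move=> l q; rewrite -scalemxAr -!scalemxAl detZ.
  - by move=> q Sq; rewrite -(mulmxA L) detS//; exact: SM.
have -> : L *m p0 *m h *m B = (L *m B0) *m (C0 *m h *m B) by rewrite p0E !mulmxA.
by move/eqP; rewrite det_mulmx mulf_eq0 (negbTE LB0) (negbTE C0hB).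
Qed.

End Zariski.

(** * Transversality in terms of subspaces and endomorphisms *)

Lemma singular_vector n (X : 'M[R]_n) : \rank X != n ->
  exists2 x : 'cV[R]_n, x != 0 & X *m x = 0.
Proof.
rewrite -det_neq0_rank negbK -det_tr => /det0P [v v0 vX]; exists v^T.
  by rewrite trmx_eq0.
by apply: trmx_inj; rewrite trmx_mul trmxK vX trmx0.
Qed.

Lemma regular_vector n (X : 'M[R]_n) (x : 'cV[R]_n) : \rank X = n -> X *m x = 0 -> x = 0.
Proof.
move=> rX Xx; have /full_col_linv [Y YX] := rX.
by rewrite -[x]mul1mx -YX -mulmxA Xx mulmx0.
Qed.

Lemma full_col_vector m n (B : 'M[R]_(m, n)) (x : 'cV[R]_n) :
  \rank B = n -> B *m x = 0 -> x = 0.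
Proof.
by move=> /full_col_linv [Y YB] Bx; rewrite -[x]mul1mx -YB -mulmxA Bx mulmx0.
Qed.

Definition mx_of_end (f : 'End('cV[R]_d)) : 'M[R]_d :=
  \matrix_(i, j) f (delta_mx j 0) i 0.

Lemma mx_of_endE f v : mx_of_end f *m v = f v.
Proof.
have -> : v = \sum_j v j 0 *: (delta_mx j 0 : 'cV[R]_d).
  apply/matrixP => i j; rewrite ord1 summxE (bigD1 i)//= !mxE !eqxx mulr1.
  rewrite big1 ?addr0// => k ki; rewrite !mxE eq_sym (negbTE ki) mulr0//.
rewrite mulmx_sumr linear_sum; apply: eq_bigr => j _.
rewrite -scalemxAr linearZ -colE; congr (_ *: _).
by apply/matrixP => i k; rewrite ord1 !mxE.
Qed.

Lemma dim_colvf n : \dim {:'cV[R]_n} = n.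
Proof. by rewrite dimvf dim_matrix; exact: muln1. Qed.

Lemma dim_limg_mx (p : 'M[R]_d) : \dim (limg (mx_end p)) = \rank p.
Proof.
have [r rp] : exists r, \rank p = r by eexists.
have [B [C [pE rB rC]]] := rank_factorization rp; rewrite rp.
pose fB : 'Hom('cV[R]_r, 'cV[R]_d) := linfun (mulmx B).
have -> : limg (mx_end p) = limg fB.
  have [C' CC'] := full_row_rinv rC.
  apply/vspaceP => v; apply/memv_imgP/memv_imgP => -[u _ ->].
    exists (C *m u); first exact: memvf.
    by rewrite mx_endE lfunE /= pE mulmxA.
  exists (C' *m u); first exact: memvf.
  by rewrite mx_endE lfunE /= pE -mulmxA (mulmxA C) CC' mul1mx.
rewrite limg_dim_eq ?dim_colvf//.
apply/eqP; rewrite -subv0; apply/subvP => x /memv_capP [_].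
rewrite memv_ker lfunE /= => /eqP Bx; rewrite memv0; apply/eqP.
exact: full_col_vector Bx.
Qed.

Lemma capv_eq0P (U V : {vspace 'cV[R]_d}) :
  (U :&: V)%VS = 0%VS <-> forall v, v \in U -> v \in V -> v = 0.
Proof.
split=> [UV0 v vU vV|UV].
  by apply/eqP; rewrite -memv0 -UV0; apply/memv_capP.
apply/eqP; rewrite -subv0; apply/subvP => x /memv_capP [xU xV].
by rewrite memv0 (UV x).
Qed.

Lemma limg_cap_ker r (p : 'M[R]_d) (L : 'M[R]_(r, d)) (W : {vspace 'cV[R]_d}) :
  \rank p = r -> (forall v, v \in W <-> L *m v = 0) ->
  (limg (mx_end p) :&: W)%VS = 0%VS <-> \rank (L *m p) = r.
Proof.
move=> rp WL; have [B [C [pE rB rC]]] := rank_factorization rp.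
have [C' CC'] := full_row_rinv rC.
have -> : \rank (L *m p) = \rank (L *m B).
  by rewrite pE mulmxA -[L *m B]mul1mx mxrank_mul_full ?mxrank1// mul1mx.
split=> [/capv_eq0P H|rLB].
  apply/eqP; apply: contrapT => /negP /singular_vector [x x0 LBx].
  case/eqP: x0; apply: (full_col_vector rB); apply: H; last first.
    by apply/WL; rewrite mulmxA.
  apply/memv_imgP; exists (C' *m x); first exact: memvf.
  by rewrite mx_endE pE -mulmxA (mulmxA C) CC' mul1mx.
apply/capv_eq0P => _ /memv_imgP [u _ ->]; rewrite mx_endE => /WL.
rewrite pE !mulmxA -mulmxA => /(regular_vector rLB) Cu.
by rewrite -mulmxA Cu mulmx0.
Qed.

Lemma cap_lker r (p : 'M[R]_d) (V : 'M[R]_(d, r)) (U : {vspace 'cV[R]_d}) :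
  \rank p = r -> \rank V = r -> (forall v, v \in U <-> exists x, v = V *m x) ->
  (U :&: lker (mx_end p))%VS = 0%VS <-> \rank (p *m V) = r.
Proof.
move=> rp rV UV; have [B [C [pE rB rC]]] := rank_factorization rp.
have -> : \rank (p *m V) = \rank (C *m V).
  by rewrite pE -mulmxA -[C *m V]mulmx1 mulmxA mxrank_mul_full ?mxrank1// mulmx1.
split=> [/capv_eq0P H|rCV].
  apply/eqP; apply: contrapT => /negP /singular_vector [x x0 CVx].
  case/eqP: x0; apply: (full_col_vector rV); apply: H.
    by apply/UV; exists x.
  by rewrite memv_ker mx_endE pE -mulmxA (mulmxA C) CVx mulmx0.
apply/capv_eq0P => v /UV [x ->]; rewrite memv_ker mx_endE pE -mulmxA => /eqP.
by move=> /(full_col_vector rB); rewrite mulmxA => /(regular_vector rCV) ->; rewrite mulmx0.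
Qed.

Lemma property_S_left S : (proximal_dim S <= d)%N ->
  property_S S <-> left_transversal S (proximal_dim S).
Proof.
set r := proximal_dim S => rd; split=> [PS L rL|LT W dW].
(* [L] is made into an endomorphism with the same kernel by composing it with a right inverse. *)
- have [K rK KL] : exists2 K : 'M[R]_d, \rank K = r & forall v : 'cV[R]_d, K *m v = 0 <-> L *m v = 0.
    have [L' LL'] := full_row_rinv rL.
    exists (L' *m L).
      apply/eqP; rewrite eqn_leq (leq_trans (mxrankM_maxr _ _)) ?rank_leq_row//=.
      by have := mxrankM_maxr L (L' *m L); rewrite mulmxA LL' mul1mx rL.
    move=> v; split=> [LLv|Lv]; last by rewrite -mulmxA Lv mulmx0.
    by rewrite -[L *m v]mul1mx -LL' -mulmxA (mulmxA L') LLv mulmx0.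
  pose W := lker (mx_end K).
  have WL v : v \in W <-> L *m v = 0.
    by rewrite memv_ker mx_endE; split=> [/eqP/KL|/KL/eqP].
  have dW : \dim W = (d - r)%N.
    have := limg_ker_dim (mx_end K) fullv.
    by rewrite capfv dim_limg_mx rK dim_colvf => dE; rewrite -[X in (X - _)%N]dE addnK.
  have [p [Sp rp] /(limg_cap_ker rp WL) rLp] := PS _ dW.
  by exists p.
(* [W] is the kernel of the complementary projector, and the second factor of its rank factorization
   is the required [L]. *)
- pose K := 1%:M - mx_of_end (projv W).
  have WK v : v \in W <-> K *m v = 0.
    rewrite mulmxBl mul1mx mx_of_endE; split=> [vW|/eqP].
      by rewrite projv_id// subrr.
    by rewrite subr_eq0 => /eqP ->; exact: memv_proj.
  have rK : \rank K = r.
    have WE : lker (mx_end K) = W.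
      apply/vspaceP => v; rewrite memv_ker mx_endE.
      by apply/eqP/idP => [/WK|/WK].
    have := limg_ker_dim (mx_end K) fullv.
    rewrite capfv WE dim_limg_mx dim_colvf dW => H.
    by apply/eqP; rewrite -(eqn_add2l (d - r)) H subnK.
  have [B [L [KE rB rL]]] := rank_factorization rK.
  have WL v : v \in W <-> L *m v = 0.
    split=> [/WK|Lv]; last by apply/WK; rewrite KE -mulmxA Lv mulmx0.
    by rewrite KE -mulmxA => /(full_col_vector rB).
  have [p [Sp rp rLp]] := LT _ rL.
  by exists p => //; apply/(limg_cap_ker rp WL).
Qed.

Lemma right_transversalP S : right_transversal S (proximal_dim S) <->
  forall V : {vspace 'cV[R]_d}, \dim V = proximal_dim S ->
    exists2 p, minimal_rank_set S p & (V :&: lker (mx_end p))%VS = 0%VS.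
Proof.
set r := proximal_dim S; split=> [RT U dU|H V rV].
- pose K := mx_of_end (projv U).
  have UE : limg (mx_end K) = U.
    have -> : mx_end K = projv U by apply/lfunP => v; rewrite mx_endE mx_of_endE.
    exact: limg_proj.
  have rK : \rank K = r by rewrite -dim_limg_mx UE.
  have [V [C [KE rV rC]]] := rank_factorization rK.
  have [C' CC'] := full_row_rinv rC.
  have UV v : v \in U <-> exists x, v = V *m x.
    rewrite -UE; split=> [/memv_imgP [u _ ->]|[x ->]].
      by exists (C *m u); rewrite mx_endE KE mulmxA.
    apply/memv_imgP; exists (C' *m x); first exact: memvf.
    by rewrite mx_endE KE -mulmxA (mulmxA C) CC' mul1mx.
  have [p [Sp rp rpV]] := RT _ rV.
  by exists p => //; apply/(cap_lker rp rV UV).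
- have [V' V'V] := full_col_linv rV.
  pose U := limg (mx_end (V *m V')).
  have UV v : v \in U <-> exists x, v = V *m x.
    split=> [/memv_imgP [u _ ->]|[x ->]].
      by exists (V' *m u); rewrite mx_endE mulmxA.
    apply/memv_imgP; exists (V *m x); first exact: memvf.
    by rewrite mx_endE -mulmxA (mulmxA V') V'V mul1mx.
  have dU : \dim U = r.
    rewrite dim_limg_mx; apply/eqP.
    rewrite eqn_leq (leq_trans (mxrankM_maxl _ _)) ?rank_leq_col//=.
    by have := mxrankM_maxl (V *m V') V; rewrite -mulmxA V'V mulmx1 rV.
  have [p [Sp rp] /(cap_lker rp rV UV) rpV] := H _ dU.
  by exists p.
Qed.

End PropertyS.

(** * Tensor powers *)

Section TensorPower.
Variables (R : realType) (d n : nat).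
Notation I := {ffun 'I_n -> 'I_d}.
Notation N := #|{: I}|.
(** Coordinates of the tensor power are numbered by ordinals so that its endomorphisms are matrices;
    [ev] recovers the multi-index. *)
Definition ev (i : 'I_N) : I := enum_val i.
Implicit Types (F G : 'I_n -> 'M[R]_d) (g h : 'M[R]_d).

(** The Kronecker product of the matrices [F k]. *)
Definition tensor_mx F : 'M[R]_N :=
  \matrix_(i, j) \prod_k F k (ev i k) (ev j k).

Definition tens g := tensor_mx (fun=> g).

(* The derivative of tens at the identity. *)
Definition dtens g : 'M[R]_N :=
  \sum_k tensor_mx (fun l => if l == k then g else 1%:M).

Lemma sum_enum_val (F : I -> R) : \sum_(i < N) F (ev i) = \sum_f F f.
Proof.
rewrite [RHS](reindex (@enum_val _ (mem {: I})))//=.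
by apply: onW_bij; exact: enum_val_bij.
Qed.

Lemma tensor_mxM F G : tensor_mx F *m tensor_mx G = tensor_mx (fun k => F k *m G k).
Proof.
apply/matrixP => i j; rewrite !mxE.
transitivity (\sum_(f : I) \prod_k (F k (ev i k) (f k) * G k (f k) (ev j k))).
  rewrite -sum_enum_val; apply: eq_bigr => l _.
  by rewrite !mxE -big_split.
rewrite -(bigA_distr_bigA (fun k a => F k (ev i k) a * G k a (ev j k))).
by apply: eq_bigr => k _; rewrite mxE.
Qed.

Lemma tensor_mx_tr F : (tensor_mx F)^T = tensor_mx (fun k => (F k)^T).
Proof. by apply/matrixP => i j; rewrite !mxE; apply: eq_bigr => k _; rewrite mxE. Qed.

Lemma tensor_mx_ext F G : F =1 G -> tensor_mx F = tensor_mx G.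
Proof.
by move=> FG; apply/matrixP => i j; rewrite !mxE; apply: eq_bigr => k _; rewrite FG.
Qed.

Lemma enum_val_neq (i j : 'I_N) : i != j -> exists k, ev i k != ev j k.
Proof.
move=> ij; apply: contrapT => H; case/eqP: ij; apply: enum_val_inj; rewrite -/(ev i) -/(ev j); apply/ffunP => k.
by apply/eqP; apply: contrapT => /negP ?; apply: H; exists k.
Qed.

Lemma tensM g h : tens (g *m h) = tens g *m tens h.
Proof. by rewrite /tens tensor_mxM. Qed.

Lemma tens_tr g : tens g^T = (tens g)^T.
Proof. by rewrite /tens tensor_mx_tr. Qed.

Lemma tens_diag (a : 'rV[R]_d) :
  tens (diag_mx a) = diag_mx (\row_j \prod_k a 0 (ev j k)).
Proof.
apply/matrixP => i j; rewrite !mxE; have [->|ij] := eqVneq i j.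
  by rewrite mulr1n; apply: eq_bigr => k _; rewrite mxE eqxx mulr1n.
have [k ijk] := enum_val_neq ij.
by rewrite mulr0n (bigD1 k)//= mxE (negbTE ijk) mulr0n mul0r.
Qed.

Lemma tens1 : tens 1%:M = 1%:M.
Proof.
rewrite -diag_const_mx tens_diag -diag_const_mx; congr diag_mx.
by apply/rowP => j; rewrite !mxE big1// => k _; rewrite mxE.
Qed.

Lemma tens_unit g : g \in unitmx -> tens g \in unitmx.
Proof.
move=> gu; have : tens g *m tens (invmx g) = 1%:M by rewrite -tensM mulmxV// tens1.
by move=> /mulmx1_unit [].
Qed.

Lemma tens_orthogonal g : g^T *m g = 1%:M -> (tens g)^T *m tens g = 1%:M.
Proof. by move=> gg; rewrite -tens_tr -tensM gg tens1. Qed.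

Lemma tensZ l g : tens (l *: g) = l ^+ n *: tens g.
Proof.
apply/matrixP => i j; rewrite !mxE; under eq_bigr do rewrite mxE.
by rewrite big_split /= prodr_const card_ord.
Qed.

Lemma continuous_tens (T : topologicalType) (f : T -> 'M[R]_d) :
  continuous f -> continuous (fun x => tens (f x)).
Proof.
move=> cf; apply: continuous_mx => i j; under eq_fun do rewrite mxE.
by apply: continuous_bigprod => k _; exact: continuous_entry.
Qed.

Lemma dtens_conj g h x : g *m h = 1%:M -> tens g *m dtens x *m tens h = dtens (g *m x *m h).
Proof.
move=> gh; rewrite /dtens mulmx_sumr mulmx_suml; apply: eq_bigr => k _.
rewrite /tens !tensor_mxM; apply: tensor_mx_ext => l /=.
by case: eqP => // _; rewrite mulmx1 gh.
Qed.

Lemma dtens_diag (a : 'rV[R]_d) :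
  dtens (diag_mx a) = diag_mx (\row_j \sum_k a 0 (ev j k)).
Proof.
apply/matrixP => i j; rewrite !mxE summxE; have [->|ij] := eqVneq i j.
  rewrite mulr1n; apply: eq_bigr => k _; rewrite mxE (bigD1 k)//= eqxx mxE eqxx mulr1n.
  by rewrite big1 ?mulr1// => l /negbTE ->; rewrite mxE eqxx.
have [l ijl] := enum_val_neq ij.
rewrite mulr0n big1// => k _; rewrite mxE (bigD1 l)//=.
by case: ifP => _; rewrite mxE (negbTE ijl) ?mulr0n mul0r.
Qed.

Lemma dtensE x i j : dtens x i j =
  \sum_k x (ev i k) (ev j k) *
    \prod_(l | l != k) (1%:M : 'M[R]_d) (ev i l) (ev j l).
Proof.
rewrite summxE; apply: eq_bigr => k _; rewrite mxE (bigD1 k)//= eqxx.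
by congr (_ * _); apply: eq_bigr => l /negbTE ->.
Qed.

Lemma dtens_linear a x z : dtens (a *: x + z) = a *: dtens x + dtens z.
Proof.
apply/matrixP => i j; rewrite [RHS]mxE [X in _ = X + _]mxE !dtensE mulr_sumr -big_split.
by apply: eq_bigr => k _; rewrite /= !mxE; ring.
Qed.

Lemma dtens_tr x : (dtens x)^T = dtens x^T.
Proof.
apply/matrixP => i j; rewrite mxE !dtensE; apply: eq_bigr => k _; rewrite mxE.
by congr (_ * _); apply: eq_bigr => l _; rewrite !mxE eq_sym.
Qed.

(** A linear functional on matrices is the trace against a fixed matrix. When [P] is the orthogonal
    projector on a row space, [M] is the moment of that space. *)
Lemma dtens_trace (P : 'M[R]_N) : P^T = P -> exists M : 'M[R]_d, M^T = M /\
  forall x, \tr (P *m dtens x) = \tr (M *m x).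
Proof.
move=> PT; exists (\matrix_(a, b) \tr (P *m dtens (delta_mx b a))); split.
  apply/matrixP => a b; rewrite !mxE -mxtrace_tr trmx_mul dtens_tr trmx_delta PT.
  by rewrite mxtrace_mulC.
move=> x; pose f z := \tr (P *m dtens z).
have fL a z z' : f (a *: z + z') = a * f z + f z'.
  by rewrite /f dtens_linear mulmxDr -scalemxAr mxtraceD mxtraceZ.
have f0 : f 0 = 0 by have := fL (-1) 0 0; rewrite scaler0 addr0 mulN1r addNr.
have fD z z' : f (z + z') = f z + f z' by have := fL 1 z z'; rewrite scale1r mul1r.
rewrite -/(f x) {1}[x]matrix_sum_delta (big_morph f fD f0) /mxtrace.
under eq_bigr do rewrite (big_morph f fD f0).
rewrite exchange_big; apply: eq_bigr => j _; rewrite mxE; apply: eq_bigr => i _.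
by rewrite -[X in f X]addr0 fL f0 addr0 mulrC mxE.
Qed.

End TensorPower.

(** * Logarithms of positive definite matrices *)

Section SpectralFunctions.
Variable R : realType.
Implicit Types (n k : nat).

Lemma ln_le_subr1 (x : R) : 0 < x -> ln x <= x - 1.
Proof.
by move=> x0; rewrite -{1}[x](subrKC 1); apply: le_ln1Dx; lra.
Qed.

Lemma ln_eq_subr1 (x : R) : 0 < x -> ln x = x - 1 -> x = 1.
Proof.
move=> x0 lx; have [l0|/expR_gt1Dx] := eqVneq (ln x) 0; first lra.
rewrite lnK ?posrE//; lra.
Qed.

Lemma orthogonal_tr n (U : 'M[R]_n) : U^T *m U = 1%:M -> U *m U^T = 1%:M.
Proof. exact: mulmx1C. Qed.

Lemma diag_quad n k (z : 'M[R]_(k, n)) (b : 'rV[R]_n) i j :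
  (z *m diag_mx b *m z^T) i j = \sum_f z i f * b 0 f * z j f.
Proof. by rewrite mxE; apply: eq_bigr => f _; rewrite mul_mx_diag !mxE. Qed.

Lemma spectral_diag_ge0 n k (z : 'M[R]_(k, n)) (U : 'M[R]_k) (a : 'rV[R]_k) :
  U^T *m U = 1%:M -> z *m z^T = U *m diag_mx a *m U^T -> forall i, 0 <= a 0 i.
Proof.
move=> UU zE i.
have -> : a 0 i = ((U^T *m z) *m (U^T *m z)^T) i i.
  rewrite trmx_mul trmxK -mulmxA (mulmxA z) zE !mulmxA UU mul1mx -mulmxA UU mulmx1.
  by rewrite mxE eqxx mulr1n.
by rewrite mxE; apply: sumr_ge0 => j _; rewrite [X in _ * X]mxE -expr2 sqr_ge0.
Qed.

Lemma spectral_det n (U : 'M[R]_n) (a : 'rV[R]_n) :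
  U^T *m U = 1%:M -> \det (U *m diag_mx a *m U^T) = \prod_i a 0 i.
Proof.
move=> UU; rewrite !det_mulmx mulrAC -det_mulmx (orthogonal_tr UU) det1 mul1r.
exact: det_diag.
Qed.

Lemma spectral_trace n (U : 'M[R]_n) (a : 'rV[R]_n) :
  U^T *m U = 1%:M -> \tr (U *m diag_mx a *m U^T) = \sum_i a 0 i.
Proof.
move=> UU; rewrite mxtrace_mulC mulmxA UU mul1mx.
by apply: eq_bigr => i _; rewrite mxE eqxx mulr1n.
Qed.

Lemma spectral_diag_gt0 n (z : 'M[R]_n) (U : 'M[R]_n) (a : 'rV[R]_n) :
  z \in unitmx -> U^T *m U = 1%:M -> z *m z^T = U *m diag_mx a *m U^T ->
  forall i, 0 < a 0 i.
Proof.
move=> zu UU zE i; rewrite lt_def (spectral_diag_ge0 UU zE) andbT.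
apply: contraTneq zu => ai0; rewrite unitmxE unitfE negbK -sqrf_eq0 expr2.
by rewrite -[X in _ * X]det_tr -det_mulmx zE spectral_det// (bigD1 i)//= ai0 mul0r.
Qed.

(* Jensen's inequality for the compression of ln to the row space of y, in the form
   ln x <= x - 1 applied to each matrix coefficient. *)
Lemma spectral_jensen n k (y : 'M[R]_(k, n)) (U : 'M[R]_n) (b : 'rV[R]_n) (s : 'M[R]_k) :
  y *m y^T = 1%:M -> U^T *m U = 1%:M -> (forall f, 0 < b 0 f) -> s \in unitmx ->
  y *m (U *m diag_mx b *m U^T) *m y^T = s *m s^T ->
  \tr (y *m (U *m diag_mx (map_mx (@ln R) b) *m U^T) *m y^T) <= ln (\det (s *m s^T)) /\
  (\tr (y *m (U *m diag_mx (map_mx (@ln R) b) *m U^T) *m y^T) = ln (\det (s *m s^T)) ->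
   exists t, y *m (U *m diag_mx b *m U^T) = t *m y).
Proof.
move=> yy UU b0 su ss.
have [|Q [a [QQ aE]]] := @symmetric_spectral R k (s *m s^T).
  by rewrite trmx_mul trmxK.
have a0 := spectral_diag_gt0 su QQ aE.
(* In eigenbases of both sides the rows of [z] are unit vectors, whose squared entries are the
   weights in Jensen's inequality. *)
have [z zdef] : exists z : 'M[R]_(k, n), z = Q^T *m (y *m U) by eexists.
have zT : z^T = U^T *m y^T *m Q by rewrite zdef !trmx_mul trmxK.
have zz : z *m z^T = 1%:M.
  rewrite zT zdef -!mulmxA (mulmxA U) (orthogonal_tr UU) mul1mx.
  by rewrite (mulmxA y) yy mul1mx QQ.
have yz (c : 'rV[R]_n) : y *m (U *m diag_mx c *m U^T) *m y^T =
    Q *m (z *m diag_mx c *m z^T) *m Q^T.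
  rewrite zT zdef !mulmxA (orthogonal_tr QQ) mul1mx -!mulmxA.
  by rewrite (orthogonal_tr QQ) mulmx1.
have zbz : z *m diag_mx b *m z^T = diag_mx a.
  have := ss; rewrite yz aE => /(congr1 (fun X => Q^T *m X *m Q)).
  by rewrite !mulmxA QQ !mul1mx -!mulmxA QQ !mulmx1.
have w1 j : \sum_f z j f ^+ 2 = 1.
  move/matrixP/(_ j j): zz; rewrite !mxE eqxx mulr1n => <-.
  by apply: eq_bigr => f _; rewrite mxE expr2.
have wb j : \sum_f z j f ^+ 2 * b 0 f = a 0 j.
  move/matrixP/(_ j j): zbz; rewrite diag_quad mxE eqxx mulr1n => <-.
  by apply: eq_bigr => f _; rewrite expr2 mulrAC.
(* The weighted defect of [ln x <= x - 1] at [x = b 0 f / a 0 j]; the defects add up to the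
   difference of the two sides. *)
pose e j f := z j f ^+ 2 * (b 0 f / a 0 j - 1 - ln (b 0 f / a 0 j)).
have e0 j f : 0 <= e j f.
  rewrite /e mulr_ge0 ?sqr_ge0// subr_ge0 ln_le_subr1// divr_gt0//.
have trE : \tr (y *m (U *m diag_mx (map_mx (@ln R) b) *m U^T) *m y^T) =
    \sum_j \sum_f z j f ^+ 2 * ln (b 0 f).
  rewrite yz mxtrace_mulC (mulmxA Q^T) QQ mul1mx; apply: eq_bigr => j _.
  by rewrite diag_quad; apply: eq_bigr => f _; rewrite mxE expr2 mulrAC.
have detE : ln (\det (s *m s^T)) = \sum_j ln (a 0 j).
  rewrite aE spectral_det//.
  have [_ ->] : 0 < \prod_j a 0 j /\ ln (\prod_j a 0 j) = \sum_j ln (a 0 j).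
    elim/big_ind2: _ => [|x1 x2 y1 y2 [? <-] [? <-]|j _]; rewrite ?ln1//.
    by rewrite mulr_gt0// lnM.
  by [].
have sumE : \sum_j \sum_f e j f = ln (\det (s *m s^T)) -
    \tr (y *m (U *m diag_mx (map_mx (@ln R) b) *m U^T) *m y^T).
  rewrite trE detE -sumrB; apply: eq_bigr => j _.
  transitivity (\sum_f (z j f ^+ 2 * b 0 f * (a 0 j)^-1 +
      z j f ^+ 2 * (ln (a 0 j) - 1) - z j f ^+ 2 * ln (b 0 f))).
    by apply: eq_bigr => f _; rewrite /e ln_div ?posrE//; ring.
  rewrite sumrB big_split /= -!mulr_suml w1 wb divff ?gt_eqF//; ring.
split.
  rewrite -subr_ge0 -sumE; apply: sumr_ge0 => j _; exact: sumr_ge0.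
move=> eqE.
have ee j f : e j f = 0.
  have : \sum_j \sum_f e j f == 0 by rewrite sumE eqE subrr.
  rewrite psumr_eq0 => [/allP/(_ j)|i _]; last exact: sumr_ge0.
  rewrite mem_index_enum => /(_ isT) /=; rewrite psumr_eq0// => /allP/(_ f).
  by rewrite mem_index_enum => /(_ isT)/eqP.
(* Vanishing defects give [b 0 f = a 0 j] wherever [z j f] is nonzero, so that [z] intertwines the
   two diagonal matrices. *)
have zb : z *m diag_mx b = diag_mx a *m z.
  apply/matrixP => j f; rewrite mul_mx_diag mul_diag_mx !mxE.
  have /eqP := ee j f; rewrite /e mulf_eq0 sqrf_eq0 => /orP[/eqP ->|].
    by rewrite mul0r mulr0.
  rewrite subr_eq0 => /eqP/esym/ln_eq_subr1 ba.
  have {}ba : b 0 f / a 0 j = 1 by apply: ba; rewrite divr_gt0.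
  rewrite mulrC; congr (_ * _).
  by rewrite -[b 0 f](divfK (lt0r_neq0 (a0 j))) ba mul1r.
exists (Q *m diag_mx a *m Q^T).
have -> : y = Q *m z *m U^T.
  by rewrite zdef !mulmxA (orthogonal_tr QQ) mul1mx -mulmxA (orthogonal_tr UU) mulmx1.
rewrite !mulmxA -(mulmxA _ U^T) UU mulmx1 -(mulmxA _ Q^T) QQ mulmx1.
by rewrite -(mulmxA Q z) zb !mulmxA.
Qed.

(** Taylor upper bound of order 2 for the square of the logarithm on a compact interval, proved in
    the relative increment [y = b / a - 1]. *)
Lemma lnsq_bound (al be : R) : 0 < al -> exists2 K : R, 0 <= K &
  forall a b, al <= a <= be -> al <= b <= be ->
  ln b ^+ 2 <= ln a ^+ 2 + 2 * (ln a / a * (b - a)) + K * (b - a) ^+ 2.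
Proof.
move=> al0; pose M := `|ln al| + `|ln be|.
have M0 : 0 <= M by rewrite addr_ge0.
have lnM' a : al <= a <= be -> `|ln a| <= M.
  move=> /andP[ala abe]; have a0 : 0 < a by apply: lt_le_trans ala.
  have b0 : 0 < be by apply: lt_le_trans abe.
  rewrite ler_norml; apply/andP; split.
    rewrite (@le_trans _ _ (ln al))// ?ler_ln ?posrE//.
    by rewrite lerNl (@le_trans _ _ `|ln al|) ?lerDl// -normrN ler_norm.
  rewrite (@le_trans _ _ (ln be))// ?ler_ln ?posrE//.
  by rewrite (@le_trans _ _ `|ln be|) ?lerDr// ler_norm.
(* [4 * M + 4] covers [b / a >= 2^-1], and [4 * M ^+ 2 + 8 * M] the opposite case, where
   [y ^+ 2 >= 4^-1] absorbs crude bounds. *)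
pose K' := 4 * M + 4 + 4 * M ^+ 2 + 8 * M.
have K'0 : 0 <= K' by rewrite /K' !addr_ge0// mulr_ge0// exprn_ge0.
exists (K' / al ^+ 2); first by rewrite divr_ge0// exprn_ge0// ltW.
move=> a b Ha Hb; have /andP[ala abe] := Ha; have /andP[alb bbe] := Hb.
have a0 : 0 < a by apply: lt_le_trans ala.
have b0 : 0 < b by apply: lt_le_trans alb.
pose y := b / a - 1.
have bE : b - a = y * a by rewrite /y; field; rewrite gt_eqF.
have lnb : ln b = ln a + ln (b / a) by rewrite ln_div ?posrE//; ring.
have x0 : 0 < b / a by rewrite divr_gt0.
have ub := ln_le_subr1 x0; rewrite -/y in ub.
have lnaM := lnM' _ Ha; have lnbM := lnM' _ Hb.
have step : ln b ^+ 2 <= ln a ^+ 2 + 2 * (ln a * y) + K' * y ^+ 2.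
  have y2 : 0 <= y ^+ 2 by exact: sqr_ge0.
  move: lnaM; rewrite ler_norml => /andP[lna1 lna2].
  case: (leP (2^-1) (b / a)) => hx.
    have xinv : 0 < (b / a)^-1 by rewrite invr_gt0.
    have lb := ln_le_subr1 xinv; rewrite lnV ?posrE// in lb.
    have yE : b / a = 1 + y by rewrite /y; ring.
    have y1 : 0 < 1 + y by rewrite -yE.
    pose v := y / (1 + y); have vE : v * (1 + y) = y by rewrite /v divfK// gt_eqF.
    have lbv : v <= ln (b / a).
      have -> : v = 1 - (b / a)^-1 by rewrite /v yE; field; rewrite gt_eqF.
      by move: lb; lra.
    have lb2 : y - 2 * y ^+ 2 <= ln (b / a).
      apply: le_trans lbv; rewrite /v ler_pdivlMr//.
      have : 0 <= y ^+ 2 * (1 + 2 * y) by rewrite mulr_ge0//; lra.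
      nra.
    rewrite lnb; set L := ln (b / a) in lbv lb2 ub *.
    have L2 : L ^+ 2 <= 4 * y ^+ 2.
      case: (leP 0 y) => hy.
        have v0 : 0 <= v by rewrite /v divr_ge0// ltW.
        nra.
      have v2 : 2 * y <= v.
        rewrite /v ler_pdivlMr//; have : y * (2 * y + 1) <= 0; last by nra.
        by rewrite nmulr_rle0//; lra.
      nra.
    have : ln a * (L - y) <= M * (2 * y ^+ 2).
      have := ler_norm (ln a * (L - y)); rewrite normrM => /le_trans; apply.
      by apply: ler_pM => //; [exact: lnM'|rewrite ler_norml; apply/andP; split; lra].
    rewrite /K'; have : 0 <= M ^+ 2 by exact: sqr_ge0. nra.
  have yl : y < - 2^-1 by rewrite /y; lra.
  have yg : -1 <= y by rewrite /y lerBrDr addNr ltW.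
  have y4 : 4^-1 <= y ^+ 2 by nra.
  have b2 : ln b ^+ 2 <= M ^+ 2.
    by rewrite -real_normK ?num_real// ler_pXn2r ?nnegrE.
  have : 0 <= ln a ^+ 2 by exact: sqr_ge0.
  have : - M <= ln a * y by nra.
  have : M ^+ 2 <= 4 * M ^+ 2 * y ^+ 2.
    by have : 0 <= M ^+ 2 by [exact: sqr_ge0]; nra.
  have : M * 2 <= 8 * M * y ^+ 2 by nra.
  rewrite /K'; nra.
apply: (le_trans step).
rewrite bE; have -> : ln a / a * (y * a) = ln a * y by field; rewrite gt_eqF.
rewrite lerD2l -mulrA ler_wpM2l// exprMn mulrC -mulrA ler_peMr ?sqr_ge0//.
by rewrite ler_pdivlMr ?exprn_gt0// mul1r ler_pXn2r ?nnegrE// ltW.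
Qed.

End SpectralFunctions.

(** * The squared logarithm on positive definite matrices *)

Section LogSquare.
Variable R : realType.

Lemma trace_spectral n (U V : 'M[R]_n) (x z : 'rV[R]_n) :
  \tr (U *m diag_mx x *m U^T *m (V *m diag_mx z *m V^T)) =
  \sum_i \sum_j (U^T *m V) i j ^+ 2 * (x 0 i * z 0 j).
Proof.
rewrite -!mulmxA mxtrace_mulC -!mulmxA.
have -> : V^T *m U = (U^T *m V)^T by rewrite trmx_mul trmxK.
rewrite (mulmxA U^T); set W := U^T *m V.
rewrite /mxtrace; apply: eq_bigr => i _; rewrite mul_diag_mx mxE mulmxA diag_quad mulr_sumr.
by apply: eq_bigr => j _; ring.
Qed.

Lemma orthogonal_row n (W : 'M[R]_n) i : W *m W^T = 1%:M -> \sum_j W i j ^+ 2 = 1.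
Proof.
move=> /matrixP/(_ i i); rewrite !mxE eqxx mulr1n => <-.
by apply: eq_bigr => j _; rewrite mxE expr2.
Qed.

(** An inequality of Klein's type: the squared entries of [U^T *m V] are doubly stochastic, and
    averaging the scalar bound [lnsq_bound] with these weights gives the bound for traces. *)
Lemma spectral_klein n (al be : R) : 0 < al -> exists2 K : R, 0 <= K &
  forall (U V : 'M[R]_n) (a b : 'rV[R]_n), U^T *m U = 1%:M -> V^T *m V = 1%:M ->
  (forall i, al <= a 0 i <= be) -> (forall i, al <= b 0 i <= be) ->
  let A := U *m diag_mx a *m U^T in let B := V *m diag_mx b *m V^T in
  let G := U *m diag_mx (\row_i (ln (a 0 i) / a 0 i)) *m U^T in
  is_true (\sum_i ln (b 0 i) ^+ 2 <=
    \sum_i ln (a 0 i) ^+ 2 + 2 * \tr (G *m (B - A)) + K * frob (B - A)).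
Proof.
move=> al0; have [K K0 HK] := lnsq_bound be al0; exists K => // U V a b UU VV Ha Hb A B G.
pose W := U^T *m V.
have WW : W *m W^T = 1%:M.
  by rewrite /W trmx_mul trmxK -mulmxA (mulmxA V) (orthogonal_tr VV) mul1mx.
have WtW : W^T *m W = 1%:M by exact: mulmx1C.
pose w i j := W i j ^+ 2.
have w1 i : \sum_j w i j = 1 by exact: orthogonal_row.
have w2 j : \sum_i w i j = 1.
  rewrite -(@orthogonal_row n W^T j) ?trmxK//.
  by apply: eq_bigr => i _; rewrite mxE.
have sumb (f : R -> R) : \sum_j f (b 0 j) = \sum_i \sum_j w i j * f (b 0 j).
  by rewrite exchange_big; apply: eq_bigr => j _; rewrite -mulr_suml w2 mul1r.
have suma (f : R -> R) : \sum_i f (a 0 i) = \sum_i \sum_j w i j * f (a 0 i).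
  by apply: eq_bigr => i _; rewrite -mulr_suml w1 mul1r.
have AT : A^T = A by rewrite /A !trmx_mul trmxK tr_diag_mx mulmxA.
have BT : B^T = B by rewrite /B !trmx_mul trmxK tr_diag_mx mulmxA.
have trAB x : \tr (U *m diag_mx x *m U^T *m B) = \sum_i \sum_j w i j * (x 0 i * b 0 j).
  exact: trace_spectral.
have trAA x : \tr (U *m diag_mx x *m U^T *m A) = \sum_i \sum_j w i j * (x 0 i * a 0 i).
  rewrite /A trace_spectral UU; apply: eq_bigr => i _.
  rewrite -mulr_suml w1 mul1r (bigD1 i)//= mxE eqxx expr1n mul1r big1 ?addr0// => j ji.
  by rewrite mxE eq_sym (negbTE ji) expr0n mul0r.
have trBB : \tr (B *m B) = \sum_i \sum_j w i j * (b 0 j * b 0 j).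
  rewrite -(sumb (fun t => t * t)).
  have -> : B *m B = V *m diag_mx (\row_i (b 0 i * b 0 i)) *m V^T.
    by rewrite /B -!mulmxA (mulmxA V^T V) VV mul1mx (mulmxA (diag_mx _)) mulmx_diag.
  by rewrite spectral_trace//; apply: eq_bigr => i _; rewrite mxE.
have frobBA : frob (B - A) = \sum_i \sum_j w i j * (b 0 j - a 0 i) ^+ 2.
  have -> : frob (B - A) = \tr (B *m B) - \tr (A *m B) - (\tr (A *m B) - \tr (A *m A)).
    rewrite frobE (_ : (B - A)^T = B - A); last by rewrite linearB /= AT BT.
    by rewrite mulmxBl !mulmxBr !raddfB /= (mxtrace_mulC B A).
  rewrite trBB trAA trAB -!sumrB.
  apply: eq_bigr => i _; rewrite -!sumrB; apply: eq_bigr => j _; ring.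
rewrite (sumb (fun t => ln t ^+ 2)) (suma (fun t => ln t ^+ 2)) frobBA mulmxBr raddfB /=.
rewrite trAB trAA -sumrB !mulr_sumr -!big_split; apply: ler_sum => i _ /=.
rewrite -sumrB !mulr_sumr -!big_split; apply: ler_sum => j _ /=.
rewrite !mxE -mulrBr [K * _]mulrCA [2 * _]mulrCA -!mulrDr ler_wpM2l ?sqr_ge0//.
by rewrite -mulrBr; exact: HK.
Qed.

(** A choice of eigenvalues with multiplicity; the default 0 is taken when the matrix is not
    orthogonally diagonalisable. *)
Definition eigs n (A : 'M[R]_n) : 'rV[R]_n :=
  xget 0 [set a | exists U : 'M[R]_n, U^T *m U = 1%:M /\ A = U *m diag_mx a *m U^T].

(** For [A] positive definite, the squared Frobenius norm of its logarithm. *)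
Definition lnsq n (A : 'M[R]_n) : R := \sum_i ln (eigs A 0 i) ^+ 2.

Lemma eigsP n (A : 'M[R]_n) : A^T = A ->
  exists U : 'M[R]_n, U^T *m U = 1%:M /\ A = U *m diag_mx (eigs A) *m U^T.
Proof.
move=> AT; have [U [a [UU AE]]] := symmetric_spectral AT.
by apply: (@xgetPex _ 0 [set a | exists U : 'M[R]_n, U^T *m U = 1%:M /\
  A = U *m diag_mx a *m U^T]); exists a, U.
Qed.

Lemma lnsq_ge0 n (A : 'M[R]_n) : 0 <= lnsq A.
Proof. by apply: sumr_ge0 => i _; exact: sqr_ge0. Qed.

Lemma gram_sym m n (T : 'M[R]_(m, n)) : (T *m T^T)^T = T *m T^T.
Proof. by rewrite trmx_mul trmxK. Qed.

Lemma gram_sym_tr m n (T : 'M[R]_(m, n)) : (T^T *m T)^T = T^T *m T.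
Proof. by rewrite trmx_mul trmxK. Qed.

Lemma gram_eigs n (T : 'M[R]_n) : exists U : 'M[R]_n,
  U^T *m U = 1%:M /\ T *m T^T = U *m diag_mx (eigs (T *m T^T)) *m U^T.
Proof. by apply: eigsP; exact: gram_sym. Qed.

Lemma gram_trace m n (T : 'M[R]_(m, n)) : \tr (T *m T^T) = frob T.
Proof. by rewrite mxtrace_mulC frobE. Qed.

Lemma gram_eigs_ge0 n (T : 'M[R]_n) i : 0 <= eigs (T *m T^T) 0 i.
Proof. by have [U [UU TE]] := gram_eigs T; exact: (spectral_diag_ge0 UU TE). Qed.

(** Each eigenvalue is at most the trace. Their product is [\det T ^+ 2], so each is also at least
    this product over a bound for the others; the exponent [n] instead of [n - 1] is harmless as
    [1 <= be]. *)
Lemma gram_eigs_bounds n (T : 'M[R]_n) be : 1 <= be -> frob T <= be ->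
  forall i, \det T ^+ 2 / be ^+ n <= eigs (T *m T^T) 0 i <= be.
Proof.
move=> be1 Tbe i; have [U [UU TE]] := gram_eigs T; set a := eigs _ in TE *.
have a0 j : 0 <= a 0 j by exact: gram_eigs_ge0.
have abe j : a 0 j <= be.
  apply: le_trans Tbe; rewrite -gram_trace TE spectral_trace// (bigD1 j)//= lerDl.
  exact: sumr_ge0.
apply/andP; split=> //.
have be0 : 0 < be by exact: lt_le_trans be1.
rewrite ler_pdivrMr ?exprn_gt0//.
have -> : \det T ^+ 2 = \prod_j a 0 j.
  by rewrite -(spectral_det a UU) -TE det_mulmx det_tr expr2.
rewrite (bigD1 i)//= ler_wpM2l//.
apply: (@le_trans _ _ (\prod_(j < n | j != i) be)).
  by apply: ler_prod => j _; rewrite a0 abe.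
rewrite prodr_const ler_weXn2l// -[X in (_ <= X)%N]card_ord; exact: max_card.
Qed.

(** Each logarithm of an eigenvalue has square at most [c], so is at most [1 + c]; the trace is the
    sum of the exponentials. *)
Lemma lnsq_frob n (T : 'M[R]_n) c : \det T != 0 -> lnsq (T *m T^T) <= c ->
  frob T <= n%:R * expR (1 + c).
Proof.
move=> T0 Tc; have [U [UU TE]] := gram_eigs T.
have Tu : T \in unitmx by rewrite unitmxE unitfE.
have a0 := spectral_diag_gt0 Tu UU TE.
rewrite -gram_trace TE spectral_trace//.
rewrite -[n in n%:R]card_ord -sum1_card natr_sum mulr_suml; apply: ler_sum => i _.
rewrite mul1r -[leLHS]lnK ?posrE// ler_expR.
have : ln (eigs (T *m T^T) 0 i) ^+ 2 <= c.
  apply: le_trans Tc; rewrite /lnsq (bigD1 i)//= lerDl.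
  by apply: sumr_ge0 => j _; exact: sqr_ge0.
nra.
Qed.

(** [G], which is [A^-1 ln A] for [A = T *m T^T], is half the gradient of [lnsq] at [A]. The
    constant is uniform in [T] and bounds [G] too, which controls the first-order term in the proof
    of continuity. *)
Lemma gram_klein n (be de : R) : 1 <= be -> 0 < de -> exists2 K : R, 0 <= K &
  forall (T : 'M[R]_n), frob T <= be -> \det T ^+ 2 = de ->
  exists U : 'M[R]_n, [/\ U^T *m U = 1%:M,
   T *m T^T = U *m diag_mx (eigs (T *m T^T)) *m U^T,
   frob (U *m diag_mx (\row_i (ln (eigs (T *m T^T) 0 i) / eigs (T *m T^T) 0 i)) *m U^T) <= K &
   forall T' : 'M[R]_n, frob T' <= be -> \det T' ^+ 2 = de ->
   let G := U *m diag_mx (\row_i (ln (eigs (T *m T^T) 0 i) / eigs (T *m T^T) 0 i)) *m U^T in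
   is_true (lnsq (T' *m T'^T) <= lnsq (T *m T^T) +
     2 * \tr (G *m (T' *m T'^T - T *m T^T)) + K * frob (T' *m T'^T - T *m T^T))].
Proof.
move=> be1 de0; pose al := de / be ^+ n.
have be0 : 0 < be by exact: lt_le_trans be1.
have al0 : 0 < al by rewrite divr_gt0// exprn_gt0.
have [K K0 HK] := @spectral_klein n al be al0.
pose M := `|ln al| + `|ln be|.
pose K' := n%:R * (M / al) ^+ 2.
have K'0 : 0 <= K' by rewrite mulr_ge0// sqr_ge0.
exists (K + K'); first exact: addr_ge0.
move=> T Tbe Tde; have [U [UU TE]] := gram_eigs T; exists U.
have bnd (T1 : 'M[R]_n) : frob T1 <= be -> \det T1 ^+ 2 = de ->
    forall i, al <= eigs (T1 *m T1^T) 0 i <= be.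
  by move=> T1be T1de i; rewrite /al -T1de; exact: gram_eigs_bounds.
split=> //.
  have -> : forall x : 'rV[R]_n, frob (U *m diag_mx x *m U^T) = \sum_i x 0 i ^+ 2.
    move=> x; rewrite frobE (_ : _^T = U *m diag_mx x *m U^T); last first.
      by rewrite !trmx_mul trmxK tr_diag_mx mulmxA.
    rewrite trace_spectral UU.
    apply: eq_bigr => i _; rewrite (bigD1 i)//= mxE eqxx expr1n mul1r -expr2.
    by rewrite big1 ?addr0// => j ji; rewrite mxE eq_sym (negbTE ji) expr0n mul0r.
  apply: (@le_trans _ _ K'); last by rewrite lerDr.
  rewrite /K' -[n in n%:R]card_ord -sum1_card natr_sum mulr_suml; apply: ler_sum => i _.
  have /andP[ala abe] := bnd _ Tbe Tde i; rewrite mxE mul1r.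
  set a := eigs _ 0 i in ala abe *.
  have a0 : 0 < a by exact: lt_le_trans ala.
  rewrite -real_normK ?num_real// ler_pXn2r ?nnegrE//; last first.
    by rewrite divr_ge0 ?addr_ge0// ltW.
  rewrite normrM normfV (gtr0_norm a0) ler_pM ?invr_ge0 ?(ltW a0)//; last by rewrite lef_pV2.
  rewrite ler_norml; apply/andP; split.
    rewrite (@le_trans _ _ (ln al))// ?ler_ln ?posrE//.
    by rewrite lerNl (@le_trans _ _ `|ln al|) ?lerDl// -normrN ler_norm.
  rewrite (@le_trans _ _ (ln be))// ?ler_ln ?posrE//.
  by rewrite (@le_trans _ _ `|ln be|) ?lerDr// ler_norm.
move=> T' T'be T'de G; have [V [VV T'E]] := gram_eigs T'.
have := HK U V _ _ UU VV (bnd _ Tbe Tde) (bnd _ T'be T'de).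
rewrite /= -T'E -TE => /le_trans; apply; rewrite lerD2l ler_wpM2r ?frob_ge0//.
by rewrite lerDl.
Qed.

End LogSquare.

(** * Moduli of continuity and properness of conjugation *)

Section Existence.
Variable R : realType.

Lemma continuous_submx (T : topologicalType) m n (f g : T -> 'M[R]_(m, n)) :
  continuous f -> continuous g -> continuous (fun x => f x - g x).
Proof.
move=> cf cg; apply: continuous_mx => i j.
under eq_fun do rewrite !mxE; apply: continuous_add; first exact: continuous_entry.
by apply: continuous_opp; exact: continuous_entry.
Qed.

Lemma within_continuous_bound (T : topologicalType) (A : set T) (f : T -> R) :
  (forall x, A x -> exists h : T -> R, [/\ continuous h, h x = 0 &
     forall y, A y -> `|f y - f x| <= h y]) ->
  {within A, continuous f}.
Proof.
move=> Hf; apply/subspace_continuousP => x Ax; have [h [ch hx fh]] := Hf _ Ax.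
apply/cvgrPdist_lt => e e0; rewrite /within /=.
have : \forall y \near x, h y < e by apply: (cvgr_lt (h x) (ch x)); rewrite hx.
apply: filterS => y hy Ay; rewrite distrC; exact: le_lt_trans (fh _ Ay) hy.
Qed.

Lemma trace_frob n (G X : 'M[R]_n) : `|\tr (G *m X)| <= Num.sqrt (frob G * frob X).
Proof.
have fG := frob_ge0 G; have fX := frob_ge0 X.
rewrite -(@ler_pXn2r _ 2)// ?nnegrE// sqr_sqrtr ?mulr_ge0// real_normK ?num_real//.
have -> : \tr (G *m X) = \sum_(p : 'I_n * 'I_n) G p.1 p.2 * X^T p.1 p.2.
  rewrite -(pair_bigA _ (fun i j => G i j * X^T i j)) /=.
  by apply: eq_bigr => i _; rewrite mxE; apply: eq_bigr => j _; rewrite mxE.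
apply: le_trans (sum_CauchySchwarz _ _) _.
rewrite -(frob_tr X) /frob.
rewrite -(pair_bigA _ (fun i j => G i j ^+ 2)).
by rewrite -(pair_bigA _ (fun i j => X^T i j ^+ 2)).
Qed.

Lemma continuous_compact_bound (T : topologicalType) (A : set T) (f : T -> R) :
  compact A -> continuous f -> exists2 c, 1 <= c & forall x, A x -> f x <= c.
Proof.
move=> cA cf; have [A0|/set0P/negP/negPn/eqP A0] := pselect (A !=set0); last first.
  by exists 1 => // x; rewrite A0.
have [x0 _ x0min] := compact_argmin A0 cA (continuous_opp cf).
exists (Num.max 1 (f x0)); first by rewrite le_max lexx.
by move=> x Ax; rewrite le_max; apply/orP; right; rewrite -lerN2; exact: x0min.
Qed.

(** The condition [g_i h = h T_i] with [T_i] bounded is invariant under scaling of [h] and, on the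
    unit sphere, closed. If a nonzero [h] satisfying it had a left null vector [v], then [v g h]
    would vanish for every combination [g] of the [g_i], against irreducibility. So [cone_det_bound]
    applies. *)
Lemma conj_proper d (S : set 'M[R]_d) q (Z : 'M[R]_(q, d * d)) rho : (0 < d)%N ->
  bi_irreducible S -> (forall g, S g -> (mxvec g <= Z)%MS) ->
  exists2 c, 0 <= c & forall k : 'M[R]_d, \det k = 1 ->
    (forall i, frob (invmx k *m vec_mx (row i Z) *m k) <= rho) -> frob k <= c.
Proof.
move=> d0 irrS SZ; pose g i : 'M[R]_d := vec_mx (row i Z).
pose N (h : 'M[R]_d) := forall i, exists T : 'M[R]_d, frob T <= rho /\ g i *m h = h *m T.
have cid : continuous (fun X : 'M[R]_d => X) by move=> x; exact: cvg_id.
have cfrob : continuous (fun X : 'M[R]_d => frob X) by exact: continuous_frob.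
have csphere : compact [set X : 'M[R]_d | frob X = 1].
  apply: (@compact_frob _ _ _ _ 1) => [|X /= ->//].
  exact: closed_preimage_eq.
pose P i := [set h : 'M[R]_d | frob h = 1 /\ exists T : 'M[R]_d, frob T <= rho /\ g i *m h = h *m T].
(* [P i] is the projection of a compact set of pairs [(h, T)]. *)
have clP i : closed (P i).
  apply: compact_closed; first exact: norm_hausdorff.
  pose Y := ([set X : 'M[R]_d | frob X = 1] `*` [set T : 'M[R]_d | frob T <= rho]) `&`
    [set hT : 'M[R]_d * 'M[R]_d | frob (g i *m hT.1 - hT.1 *m hT.2) = 0].
  have -> : P i = fst @` Y.
    apply/seteqP; split=> [h [h1 [T [Trho gh]]]|_ [[h T] [[/= h1 Trho] /frob_eq0/eqP ghT] <-]].
      by exists (h, T) => //; split=> //=; rewrite gh subrr frobE mulmx0 mxtrace0.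
    by split=> //; exists T; split=> //; apply/eqP; rewrite -subr_eq0.
  apply: continuous_compact.
    by apply: continuous_subspaceT => x; exact: cvg_fst.
  apply: compact_closedI.
    apply: compact_setX => //; apply: (@compact_frob _ _ _ _ rho) => //.
    exact: closed_preimage_le.
  have c1 : continuous (fun hT : 'M[R]_d * 'M[R]_d => hT.1) by move=> z; exact: cvg_fst.
  have c2 : continuous (fun hT : 'M[R]_d * 'M[R]_d => hT.2) by move=> z; exact: cvg_snd.
  apply: closed_preimage_eq; apply: continuous_frob; apply: continuous_submx.
    by apply: (continuous_mulmx _ c1); exact: cst_continuous.
  exact: (continuous_mulmx c1 c2).
have [|l X NX i|X NX X0|c c0 Hc] := @cone_det_bound _ d N d0.
- rewrite (_ : mkset _ = [set X : 'M[R]_d | frob X = 1] `&` [set X | forall i, P i X]).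
    by apply: compact_closedI => //; exact: closed_forall.
  apply/seteqP; split=> [X [X1 NX]|X [X1 PX]].
    by split=> //; move=> i; split=> //; exact: NX.
  by split=> // i; have [] := PX i.
- by have [T [Trho gT]] := NX i; exists T; split=> //; rewrite -scalemxAr gT -scalemxAl.
- apply/negP => /det0P [v v0 vX].
  have [h Sh /negP] := irrS _ _ v X v0 X0; apply; apply/eqP.
  have /submxP [u hE] := SZ _ Sh.
  have -> : h = \sum_i u 0 i *: g i.
    rewrite -[h]mxvecK hE mulmx_sum_row linear_sum; apply: eq_bigr => i _.
    by rewrite linearZ.
  rewrite mulmx_sumr mulmx_suml big1// => i _; have [T [_ gT]] := NX i.
  by rewrite -scalemxAr -scalemxAl -mulmxA gT mulmxA vX mul0mx scaler0.
- exists c => // k k1 kg; apply: Hc; last by rewrite k1 normr1.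
  move=> i; exists (invmx k *m g i *m k); split; first exact: kg.
  by rewrite !mulmxA mulmxV ?mul1mx// unitmxE k1 unitr1.
Qed.

End Existence.

(** * Derivatives at 0 of functions and matrix curves *)

Section DerivativeAtZero.
Variable R : realType.
Implicit Types f g : R -> R.

Definition der0 f l := is_derive (0 : R) (1 : R) f l.

Lemma der0_eq f l l' : der0 f l -> l = l' -> der0 f l'.
Proof. by move=> ? <-. Qed.

Lemma der0_cst c : der0 (fun=> c) 0.
Proof. exact: is_derive_cst. Qed.

Lemma der0_add f g l m : der0 f l -> der0 g m -> der0 (fun s => f s + g s) (l + m).
Proof. by move=> df dg; exact: (is_deriveD df dg). Qed.

Lemma der0_mul f g l m : der0 f l -> der0 g m ->
  der0 (fun s => f s * g s) (l * g 0 + f 0 * m).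
Proof.
move=> df dg; apply: der0_eq (is_deriveM df dg) _.
by rewrite /GRing.scale /=; ring.
Qed.

Lemma der0_mulc f l c : der0 f l -> der0 (fun s => c * f s) (c * l).
Proof.
by move=> df; apply: der0_eq (der0_mul (der0_cst c) df) _; rewrite mul0r add0r.
Qed.

Lemma der0_sum (I : Type) (s : seq I) (f : I -> R -> R) (l : I -> R) :
  (forall i, der0 (f i) (l i)) -> der0 (fun x => \sum_(i <- s) f i x) (\sum_(i <- s) l i).
Proof.
move=> df; elim: s => [|i s IH].
  rewrite big_nil (_ : (fun x => _) = fun=> 0); first exact: der0_cst.
  by apply/funext => x; rewrite big_nil.
rewrite big_cons (_ : (fun x => _) = fun x => f i x + \sum_(j <- s) f j x).
  exact: der0_add.
by apply/funext => x; rewrite big_cons.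
Qed.

Lemma der0_exp f l : der0 f l -> der0 (fun s => expR (f s)) (expR (f 0) * l).
Proof.
move=> df; have := @is_derive1_comp R expR f 0 _ _ (is_derive_expR (f 0)) df.
by rewrite /der0 /comp.
Qed.

Lemma der0_expc c : der0 (fun s => expR (s * c)) c.
Proof.
apply: der0_eq (der0_exp (der0_mul (is_derive_id (0 : R) (1 : R)) (der0_cst c))) _.
by rewrite /= !mul0r expR0 addr0 !mul1r.
Qed.

Lemma der0_decrease f l : der0 f l -> l < 0 -> exists s, [/\ 0 < s, s <= 1 & f s < f 0].
Proof.
move=> [df dfl] l0.
have cvg1 : (fun h => h^-1 *: ((f \o shift 0) (h *: 1) - f 0)) @ 0^' --> l.
  by rewrite -dfl.
have lt0 : \forall h \near (0 : R)^', h^-1 *: ((f \o shift 0) (h *: 1) - f 0) < 0.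
  exact: (cvgr_lt l cvg1).
have {lt0} lt1 : \forall h \near (0 : R)^'+, h^-1 *: ((f \o shift 0) (h *: 1) - f 0) < 0.
  move: lt0; rewrite !near_withinE; apply: filterS => h H h0; apply: H.
  by rewrite gt_eqF.
have [s [[s0 s1] fs]] := filter_ex (filterI (filterI (nbhs_right_gt (0 : R))
  (nbhs_right_le (ltr01 : (0 : R) < 1))) lt1).
exists s; split=> //.
move: fs; rewrite /= /GRing.scale /= addr0 mulr1 pmulr_rlt0 ?invr_gt0//.
by rewrite subr_lt0.
Qed.

Definition mxder0 m n (X : R -> 'M[R]_(m, n)) (X' : 'M[R]_(m, n)) :=
  forall i j, der0 (fun s => X s i j) (X' i j).

Lemma mxder0_eq m n (X : R -> 'M[R]_(m, n)) X' X'' : mxder0 X X' -> X' = X'' -> mxder0 X X''.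
Proof. by move=> ? <-. Qed.

Lemma mxder0_cst m n (A : 'M[R]_(m, n)) : mxder0 (fun=> A) 0.
Proof. by move=> i j; rewrite mxE; exact: der0_cst. Qed.

Lemma mxder0_mul m n p (X : R -> 'M[R]_(m, n)) (Y : R -> 'M[R]_(n, p)) X' Y' :
  mxder0 X X' -> mxder0 Y Y' -> mxder0 (fun s => X s *m Y s) (X' *m Y 0 + X 0 *m Y').
Proof.
move=> dX dY i j.
have -> : (fun s => (X s *m Y s) i j) = fun s => \sum_k X s i k * Y s k j.
  by apply/funext => s; rewrite mxE.
apply: der0_eq (der0_sum _ (fun k => der0_mul (dX i k) (dY k j))) _.
by rewrite big_split /= !mxE.
Qed.

Lemma mxder0_mulcl m n p (A : 'M[R]_(m, n)) (Y : R -> 'M[R]_(n, p)) Y' :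
  mxder0 Y Y' -> mxder0 (fun s => A *m Y s) (A *m Y').
Proof.
by move=> dY; apply: mxder0_eq (mxder0_mul (mxder0_cst A) dY) _; rewrite mul0mx add0r.
Qed.

Lemma mxder0_mulcr m n p (X : R -> 'M[R]_(m, n)) (A : 'M[R]_(n, p)) X' :
  mxder0 X X' -> mxder0 (fun s => X s *m A) (X' *m A).
Proof.
by move=> dX; apply: mxder0_eq (mxder0_mul dX (mxder0_cst A)) _; rewrite mulmx0 addr0.
Qed.

Lemma der0_trace n (X : R -> 'M[R]_n) X' : mxder0 X X' -> der0 (fun s => \tr (X s)) (\tr X').
Proof. by move=> dX; apply: der0_sum => i; exact: dX. Qed.

Lemma der0_frob0 m n (X : R -> 'M[R]_(m, n)) X' : mxder0 X X' -> X 0 = 0 ->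
  der0 (fun s => frob (X s)) 0.
Proof.
move=> dX X0.
have -> : (fun s => frob (X s)) = fun s => \sum_i \sum_j X s i j * X s i j.
  by apply/funext => s; apply: eq_bigr => i _; apply: eq_bigr => j _; rewrite expr2.
apply: der0_eq (der0_sum _ (fun i => der0_sum _ (fun j => der0_mul (dX i j) (dX i j)))) _.
by rewrite big1// => i _; rewrite big1// => j _; rewrite X0 mxE mulr0 mul0r addr0.
Qed.

End DerivativeAtZero.

(** * Kempf-Ness argument *)

Section KempfNess.
Variables (R : realType) (d n : nat).
Notation N := #|{: {ffun 'I_n -> 'I_d}}|.

Lemma ln_prod (I : finType) (a : I -> R) : (forall i, 0 < a i) ->
  ln (\prod_i a i) = \sum_i ln (a i).
Proof.
move=> a0; have [_ ->//] : 0 < \prod_i a i /\ ln (\prod_i a i) = \sum_i ln (a i).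
elim/big_ind2: _ => [|x1 x2 y1 y2 [? <-] [? <-]|j _]; rewrite ?ln1//.
by rewrite mulr_gt0// lnM.
Qed.

Lemma stable_coef_unit k (y : 'M[R]_(k, N)) (T : 'M[R]_d) s :
  y *m y^T = 1%:M -> T \in unitmx -> y *m tens n T = s *m y -> s \in unitmx.
Proof.
move=> yy Tu yT; have : s *m (y *m tens n (invmx T) *m y^T) = 1%:M.
  by rewrite !mulmxA -yT -(mulmxA y) -tensM mulmxV// tens1 mulmx1.
by move=> /mulmx1_unit [].
Qed.

Lemma stable_inv k (y : 'M[R]_(k, N)) (T : 'M[R]_d) s :
  T \in unitmx -> s \in unitmx -> y *m tens n T = s *m y ->
  y *m tens n (invmx T) = invmx s *m y.
Proof.
move=> Tu su yT; rewrite -[y in LHS](mulKmx su) -yT -!mulmxA -tensM mulmxV//.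
by rewrite tens1 mulmx1.
Qed.

(** [dtens n] of the logarithm of [T *m T^T] is the logarithm of [tens n (T *m T^T)], as seen in an
    eigenbasis, so that this is [spectral_jensen] in the tensor power. *)
Lemma jensen_tens k (y : 'M[R]_(k, N)) (T U : 'M[R]_d) (a : 'rV[R]_d) s :
  y *m y^T = 1%:M -> T \in unitmx -> y *m tens n T = s *m y ->
  U^T *m U = 1%:M -> T *m T^T = U *m diag_mx a *m U^T ->
  let L := U *m diag_mx (map_mx (@ln R) a) *m U^T in
  is_true (\tr (y *m dtens n L *m y^T) <= ln (\det (s *m s^T))) /\
  (\tr (y *m dtens n L *m y^T) = ln (\det (s *m s^T)) ->
   exists t, y *m tens n (T *m T^T) = t *m y).
Proof.
move=> yy Tu yT UU TE L.
have a0 := spectral_diag_gt0 Tu UU TE.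
pose b : 'rV[R]_N := \row_j \prod_k0 a 0 (ev j k0).
have b0 f : 0 < b 0 f by rewrite mxE; apply: prodr_gt0.
have tensE : tens n (T *m T^T) = tens n U *m diag_mx b *m (tens n U)^T.
  by rewrite TE !tensM tens_diag tens_tr.
have dtensE : dtens n L = tens n U *m diag_mx (map_mx (@ln R) b) *m (tens n U)^T.
  rewrite /L -dtens_conj ?orthogonal_tr// tens_tr dtens_diag.
  congr (_ *m diag_mx _ *m _); apply/rowP => j; rewrite !mxE ln_prod//.
  by apply: eq_bigr => i _; rewrite mxE.
have su := stable_coef_unit yy Tu yT.
rewrite dtensE tensE; apply: spectral_jensen => //.
  exact: tens_orthogonal.
by rewrite -tensE tensM tens_tr !mulmxA yT -mulmxA -trmx_mul yT trmx_mul -!mulmxA (mulmxA y) yy mul1mx.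
Qed.

(* Jensen for T and for its inverse: \tr (M *m _) compares ln (T T^T) with ln (T^T T). *)
Lemma moment_mono k (y : 'M[R]_(k, N)) (T U : 'M[R]_d) (a : 'rV[R]_d) s (M : 'M[R]_d) :
  y *m y^T = 1%:M -> T \in unitmx -> y *m tens n T = s *m y ->
  U^T *m U = 1%:M -> T *m T^T = U *m diag_mx a *m U^T ->
  (forall x, \tr (y *m dtens n x *m y^T) = \tr (M *m x)) ->
  let L1 := U *m diag_mx (map_mx (@ln R) a) *m U^T in
  let L2 := T^T *m (U *m diag_mx (\row_i (ln (a 0 i) / a 0 i)) *m U^T) *m T in
  [/\ is_true (\tr (M *m L1) <= ln (\det (s *m s^T))),
      is_true (ln (\det (s *m s^T)) <= \tr (M *m L2)) &
      \tr L1 = \tr L2].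
Proof.
move=> yy Tu yT UU TE HM L1 L2.
have a0 := spectral_diag_gt0 Tu UU TE.
have su := stable_coef_unit yy Tu yT.
have yT' := stable_inv Tu su yT.
have Tu' : invmx T \in unitmx by rewrite unitmx_inv.
(* The columns of [T^T *m U] normalised to unit length: an orthonormal eigenbasis of [T^T *m T]. *)
pose U' := T^T *m U *m diag_mx (\row_i (Num.sqrt (a 0 i))^-1).
have sq i : (Num.sqrt (a 0 i))^-1 * (Num.sqrt (a 0 i))^-1 = (a 0 i)^-1.
  by rewrite -expr2 exprVn sqr_sqrtr// ltW.
have UU' : U'^T *m U' = 1%:M.
  rewrite /U' !trmx_mul trmxK tr_diag_mx -!mulmxA (mulmxA T) TE -!mulmxA (mulmxA U^T U) UU mul1mx.
  rewrite !mulmxA -(mulmxA _ U^T U) UU mulmx1 !mulmx_diag -diag_const_mx.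
  congr diag_mx; apply/rowP => i; rewrite !mxE mulrAC sq mulVf// gt_eqF//.
have conjE (x : 'rV[R]_d) : U' *m diag_mx x *m U'^T =
    T^T *m (U *m diag_mx (\row_i (x 0 i / a 0 i)) *m U^T) *m T.
  rewrite /U' !trmx_mul trmxK tr_diag_mx !mulmxA; congr (_ *m _ *m _).
  rewrite -!mulmxA !mulmx_diag !mulmxA; congr (_ *m diag_mx _).
  by apply/rowP => i; rewrite !mxE mulrCA sq.
clearbody U'.
have TE' : invmx T *m (invmx T)^T = U' *m diag_mx (map_mx (@GRing.inv R) a) *m U'^T.
  have TTE : T^T *m T = U' *m diag_mx a *m U'^T.
    rewrite conjE [X in diag_mx X](_ : _ = const_mx 1) ?diag_const_mx.
      by rewrite mulmx1 (orthogonal_tr UU) mulmx1.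
    by apply/rowP => i; rewrite !mxE divff// gt_eqF.
  have TTV : T^T *m T *m (U' *m diag_mx (map_mx (@GRing.inv R) a) *m U'^T) = 1%:M.
    rewrite TTE -!mulmxA (mulmxA U'^T) UU' mul1mx (mulmxA (diag_mx _)) mulmx_diag.
    rewrite [X in diag_mx X](_ : _ = const_mx 1) ?diag_const_mx ?mul1mx ?orthogonal_tr//.
    by apply/rowP => i; rewrite !mxE divff// gt_eqF.
  have XT : invmx T *m (invmx T)^T *m (T^T *m T) = 1%:M.
    by rewrite -mulmxA (mulmxA _ T^T) -trmx_mul mulmxV// trmx1 mul1mx mulVmx.
  by rewrite -[LHS]mulmx1 -TTV (mulmxA (invmx T *m _)) XT mul1mx.
have [J1 _] := jensen_tens yy Tu yT UU TE.
have [J2 _] := jensen_tens yy Tu' yT' UU' TE'.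
rewrite HM in J1; rewrite HM in J2.
(* Here [L2] appears as the logarithm of [T^T *m T], the negative of that of
   [invmx T *m (invmx T)^T]. *)
have L2E : U' *m diag_mx (map_mx (@ln R) (map_mx (@GRing.inv R) a)) *m U'^T = - L2.
  rewrite conjE /L2 -mulNmx -mulmxN; congr (_ *m _ *m _).
  rewrite -mulNmx -mulmxN; congr (_ *m _ *m _); apply/matrixP => i j; rewrite !mxE.
  by rewrite lnV ?posrE// mulNr mulNrn.
split=> //.
  move: J2; rewrite L2E mulmxN raddfN /=.
  have -> : \det (invmx s *m (invmx s)^T) = (\det (s *m s^T))^-1.
    by rewrite !det_mulmx !det_tr det_inv invfM.
  rewrite lnV ?lerN2// posrE det_mulmx det_tr -expr2 exprn_even_gt0//=.
  by rewrite -unitfE -unitmxE.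
have <- : U' *m diag_mx (map_mx (@ln R) a) *m U'^T = L2.
  rewrite conjE /L2; rewrite (_ : \row_i (map_mx (@ln R) a 0 i / a 0 i) = \row_i (ln (a 0 i) / a 0 i))//.
  by apply/rowP => i; rewrite !mxE.
by rewrite !spectral_trace.
Qed.

Lemma gram_det_ge0 k m (X : 'M[R]_(k, m)) : 0 <= \det (X *m X^T).
Proof.
have [U [UU XE]] := eigsP (gram_sym X).
by rewrite XE spectral_det//; apply: prodr_ge0 => i _; exact: (spectral_diag_ge0 UU XE).
Qed.

(** [1 + x <= expR x] at the eigenvalues. For orthonormal rows both sides equal 1, so this majorant
    touches the volume there. *)
Lemma gram_det_exp k m (X : 'M[R]_(k, m)) :
  \det (X *m X^T) <= expR (\tr (X *m X^T) - k%:R).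
Proof.
have [U [UU XE]] := eigsP (gram_sym X).
have a0 := spectral_diag_ge0 UU XE; set a := eigs _ in XE a0.
have -> : \tr (X *m X^T) - k%:R = \sum_i (a 0 i - 1).
  by rewrite XE spectral_trace// sumrB sumr_const card_ord.
rewrite XE spectral_det// expR_sum; apply: ler_prod => i _; rewrite a0 /=.
by have := @expR_ge1Dx R (a 0 i - 1); rewrite subrKC.
Qed.

(** The adjugate makes the conjugate polynomial in [h], hence continuous on all matrices; for
    [\det h = 1] it is the genuine conjugate. *)
Definition adj_conj (h g : 'M[R]_d) := \adj h *m g *m h.

Lemma adj_conjE h g : \det h = 1 -> adj_conj h g = invmx h *m g *m h.
Proof.
by move=> h1; rewrite /adj_conj /invmx unitmxE h1 unitr1 invr1 scale1r.
Qed.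

Lemma adj_conj_det h g : \det h = 1 -> \det (adj_conj h g) = \det g.
Proof.
by move=> h1; rewrite adj_conjE// !det_mulmx det_inv h1 invr1 mul1r mulr1.
Qed.

(* The first term is the squared volume of the image under tens h of the rows of y (a
   Kempf-Ness function); the second one is a sum of squared displacements. *)
Definition theta k (y : 'M[R]_(k, N)) q (gs : 'I_q -> 'M[R]_d) (h : 'M[R]_d) : R :=
  \det (y *m tens n (h *m h^T) *m y^T) +
  \sum_i lnsq (adj_conj h (gs i) *m (adj_conj h (gs i))^T).

(** No continuity of the eigenvalues is invoked: [gram_klein] used at both points bounds the
    variation of [lnsq] by a function of the distance of the Gram matrices. *)
Lemma lnsq_within (T : topologicalType) (A : set T) (X : T -> 'M[R]_d) de :
  compact A -> continuous X -> 0 < de -> (forall t, A t -> \det (X t) ^+ 2 = de) ->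
  {within A, continuous (fun t => lnsq (X t *m (X t)^T))}.
Proof.
move=> cA cX de0 Ade.
have [be be1 Abe] := continuous_compact_bound cA (continuous_frob cX).
have [K K0 HK] := @gram_klein R d be de be1 de0.
apply: within_continuous_bound => x Ax.
pose E t := X t *m (X t)^T.
have cE : continuous E by exact: (continuous_mulmx cX (continuous_trmx cX)).
pose F t := frob (E t - E x).
have cF : continuous F.
  by apply: continuous_frob; apply: (continuous_submx cE); exact: cst_continuous.
exists (fun t => 2 * Num.sqrt (K * F t) + K * F t); split.
- apply: continuous_add.
    apply: continuous_mul; first exact: cst_continuous.
    move=> t; apply: continuous_comp; last exact: sqrt_continuous.
    by move: t; apply: continuous_mul => //; exact: cst_continuous.
  by apply: continuous_mul => //; exact: cst_continuous.
- by rewrite /F subrr frobE mulmx0 mxtrace0 mulr0 sqrtr0 mulr0 addr0.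
- move=> t At; have [U [_ _ GK HU]] := HK _ (Abe _ Ax) (Ade _ Ax).
  have [V [_ _ GK' HV]] := HK _ (Abe _ At) (Ade _ At).
  have := HU _ (Abe _ At) (Ade _ At); have := HV _ (Abe _ Ax) (Ade _ Ax).
  rewrite -/(E t) -/(E x) /=; set G := U *m _ *m _; set G' := V *m _ *m _.
  have -> : frob (E x - E t) = F t by rewrite -opprB -scaleN1r frobZ sqrrN expr1n mul1r.
  rewrite -/(F t).
  have tr1 : \tr (G *m (E t - E x)) <= Num.sqrt (K * F t).
    apply: le_trans (ler_norm _) _; apply: le_trans (trace_frob _ _) _.
    by rewrite ler_wsqrtr// ler_wpM2r// frob_ge0.
  have tr2 : \tr (G' *m (E x - E t)) <= Num.sqrt (K * F t).
    apply: le_trans (ler_norm _) _; apply: le_trans (trace_frob _ _) _.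
    rewrite ler_wsqrtr// -(opprB (E t)) -scaleN1r frobZ sqrrN expr1n mul1r.
    by rewrite ler_wpM2r// frob_ge0.
  move=> H1 H2; rewrite ler_norml; apply/andP; split; move: H1 H2 tr1 tr2; lra.
Qed.

(** Where [theta] is at most its value at the identity, the conjugates are bounded by [lnsq_frob]
    and then [h] by [conj_proper]. So a minimum over a large ball is a minimum over all [h] of
    determinant 1. *)
Lemma theta_min k (y : 'M[R]_(k, N)) (S : set 'M[R]_d) q (Z : 'M[R]_(q, d * d)) :
  (0 < d)%N -> bi_irreducible S -> (forall g, S g -> (mxvec g <= Z)%MS) ->
  (forall i, vec_mx (row i Z) \in unitmx) ->
  exists2 h : 'M[R]_d, \det h = 1 & forall h' : 'M[R]_d, \det h' = 1 ->
    theta y (fun i => vec_mx (row i Z)) h <= theta y (fun i => vec_mx (row i Z)) h'.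
Proof.
move=> d0 irrS SZ Zu0; pose gs (i : 'I_q) : 'M[R]_d := vec_mx (row i Z); pose Th := theta y gs.
have gs0 i : \det (gs i) != 0 by rewrite -unitfE -unitmxE; exact: Zu0.
have Phi0 (h : 'M[R]_d) : 0 <= \det (y *m tens n (h *m h^T) *m y^T).
  rewrite tensM tens_tr mulmxA -mulmxA -trmx_mul; exact: gram_det_ge0.
have [c c0 Hc] := conj_proper (d%:R * expR (1 + Th 1%:M)) d0 irrS SZ.
(* The ball is enlarged to contain the identity, whose value is compared with those outside. *)
pose c' := Num.max c (frob (1%:M : 'M[R]_d)).
pose A := [set h : 'M[R]_d | \det h = 1] `&` [set h : 'M[R]_d | frob h <= c'].
have cid : continuous (fun X : 'M[R]_d => X) by move=> x; exact: cvg_id.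
have cA : compact A.
  apply: (@compact_frob _ _ _ _ c') => [|h []//].
  apply: closedI.
    by apply: closed_preimage_eq; exact: continuous_det.
  by apply: closed_preimage_le; exact: continuous_frob.
have A1 : A 1%:M by split; rewrite /= ?det1// /c' le_max lexx orbT.
have cTh : {within A, continuous Th}.
  apply: continuous_add.
    apply: continuous_subspaceT; apply: continuous_det.
    apply: continuous_mulmx; last exact: cst_continuous.
    apply: continuous_mulmx; first exact: cst_continuous.
    by apply: continuous_tens; apply: continuous_mulmx => //; exact: continuous_trmx.
  apply: continuous_bigsum => i _.
  apply: (@lnsq_within _ _ _ (\det (gs i) ^+ 2)) => //.
  - apply: continuous_mulmx => //; apply: continuous_mulmx; last exact: cst_continuous.
    exact: continuous_adjmx.
  - by rewrite exprn_even_gt0//= gs0.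
  - by move=> h [h1 _]; rewrite adj_conj_det.
have [|h /set_mem [h1 _] hmin] := compact_EVT_min _ cA cTh; first by exists 1%:M.
exists h => // h' h'1.
have [le1|lt1] := leP (Th h') (Th 1%:M); last first.
  apply: le_trans (hmin 1%:M _) (ltW lt1); exact/mem_set.
have hc : frob h' <= c; last first.
  by apply: hmin; apply/mem_set; split=> //=; rewrite /c' le_max hc.
apply: Hc => // i.
rewrite -adj_conjE//; apply: lnsq_frob; first by rewrite adj_conj_det//; exact: gs0.
apply: le_trans le1; rewrite /Th /theta (bigD1 i)//= addrCA lerDl addr_ge0//.
by apply: sumr_ge0 => j _; exact: lnsq_ge0.
Qed.

End KempfNess.

(** * First-order decrease along one-parameter groups *)

Section Descent.
Variables (R : realType) (d : nat).

Lemma orthonormalize k m (y : 'M[R]_(k, m)) : row_free y ->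
  exists (u : 'M[R]_k) (y0 : 'M[R]_(k, m)),
    [/\ u \in unitmx, y = u *m y0 & y0 *m y0^T = 1%:M].
Proof.
move=> yfree; have [Q [QQ yE]] := eigsP (gram_sym y); set a := eigs _ in yE.
have [z zdef] : exists z : 'M[R]_(k, m), z = Q^T *m y by eexists.
have zz : z *m z^T = diag_mx a.
  by rewrite zdef trmx_mul trmxK -mulmxA (mulmxA y) yE !mulmxA QQ mul1mx -mulmxA QQ mulmx1.
have a0 i : 0 < a 0 i.
  have -> : a 0 i = frob (row i z).
    move/matrixP/(_ i i): zz; rewrite [RHS]mxE eqxx mulr1n => <-.
    by rewrite mxE /frob big_ord1; apply: eq_bigr => j _; rewrite !mxE expr2.
  apply: frob_gt0; apply/eqP => zi.
  have : delta_mx 0 i *m (Q^T *m y) = 0 :> 'rV_m by rewrite -zdef -rowE.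
  rewrite mulmxA => /eqP; rewrite mulmx_free_eq0// => /eqP/(congr1 (fun X => X *m Q)).
  rewrite -mulmxA QQ mulmx1 mul0mx => /matrixP/(_ 0 i); rewrite !mxE !eqxx => /eqP.
  by rewrite oner_eq0.
pose D (e : R -> R) : 'M[R]_k := diag_mx (\row_i e (a 0 i)).
have sq i : Num.sqrt (a 0 i) * Num.sqrt (a 0 i) = a 0 i by rewrite -expr2 sqr_sqrtr// ltW.
have sq0 i : Num.sqrt (a 0 i) != 0 by rewrite sqrtr_eq0 -ltNge.
pose Ds := D Num.sqrt; pose Di := D (fun x => (Num.sqrt x)^-1).
have DsDi : Ds *m Di = 1%:M.
  rewrite /Ds /Di /D mulmx_diag -diag_const_mx; congr diag_mx.
  by apply/rowP => i; rewrite !mxE divff.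
exists (Q *m Ds), (Di *m z); split.
- rewrite unitmx_mul; have [_ ->] := mulmx1_unit QQ.
  by have [->] := mulmx1_unit DsDi.
- by rewrite -mulmxA (mulmxA Ds) DsDi mul1mx zdef mulmxA (orthogonal_tr QQ) mul1mx.
- rewrite trmx_mul tr_diag_mx -mulmxA (mulmxA z) zz /Di /D !mulmx_diag -diag_const_mx.
  congr diag_mx; apply/rowP => i; rewrite !mxE.
  by move: (sq i) (sq0 i); move: (Num.sqrt _) => x <- x0; field.
Qed.

Lemma frob_spectral (U : 'M[R]_d) (x : 'rV[R]_d) : U^T *m U = 1%:M ->
  frob (U *m diag_mx x *m U^T) = \sum_i x 0 i ^+ 2.
Proof.
move=> UU; rewrite frobE !trmx_mul trmxK tr_diag_mx -!mulmxA (mulmxA U^T U) UU mul1mx.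
rewrite (mulmxA (diag_mx x)) mulmx_diag mulmxA spectral_trace//.
by apply: eq_bigr => i _; rewrite mxE expr2.
Qed.

Variables (O : 'M[R]_d) (mu : 'rV[R]_d).
Hypothesis (OO : O^T *m O = 1%:M) (mu0 : \sum_i mu 0 i = 0).
Let m := O *m diag_mx mu *m O^T.

(** The one-parameter group [exp (s c m)], written in the eigenbasis of [m]. *)
Definition mexp c s : 'M[R]_d := O *m diag_mx (\row_i expR (s * (c * mu 0 i))) *m O^T.

Lemma mexp0 c : mexp c 0 = 1%:M.
Proof.
rewrite /mexp [X in diag_mx X](_ : _ = const_mx 1).
  by rewrite diag_const_mx mulmx1 orthogonal_tr.
by apply/rowP => i; rewrite !mxE mul0r expR0.
Qed.

Lemma mexp_det c s : \det (mexp c s) = 1.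
Proof.
rewrite /mexp spectral_det//; under eq_bigr do rewrite mxE.
by rewrite -expR_sum -!mulr_sumr mu0 !mulr0 expR0.
Qed.

Lemma mexp_tr c s : (mexp c s)^T = mexp c s.
Proof. by rewrite /mexp !trmx_mul trmxK tr_diag_mx mulmxA. Qed.

Lemma mexpM c c' s : mexp c s *m mexp c' s = mexp (c + c') s.
Proof.
rewrite /mexp -!mulmxA (mulmxA O^T O) OO mul1mx (mulmxA (diag_mx _)) mulmx_diag.
congr (_ *m (diag_mx _ *m _)); apply/rowP => i; rewrite !mxE -expRD; congr expR.
by rewrite mulrDl mulrDr.
Qed.

Lemma mexp_inv c s : invmx (mexp c s) = mexp (- c) s.
Proof.
have E : mexp (- c) s *m mexp c s = 1%:M.
  rewrite mexpM addNr /mexp [X in diag_mx X](_ : _ = const_mx 1).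
    by rewrite diag_const_mx mulmx1 orthogonal_tr.
  by apply/rowP => i; rewrite !mxE mul0r mulr0 expR0.
have [_ u] := mulmx1_unit E.
by rewrite -[LHS]mul1mx -E -mulmxA mulmxV// mulmx1.
Qed.

Lemma mexp_der c : mxder0 (mexp c) (c *: m).
Proof.
have dD : mxder0 (fun s => diag_mx (\row_i expR (s * (c * mu 0 i)))) (c *: diag_mx mu).
  move=> i j; rewrite !mxE.
  have -> : (fun s => (diag_mx (\row_i expR (s * (c * mu 0 i)))) i j) =
      fun s => (i == j)%:R * expR (s * (c * mu 0 i)).
    by apply/funext => s; rewrite !mxE mulr_natl.
  apply: der0_eq (der0_mulc _ (der0_expc _)) _.
  by rewrite mulr_natl mulrnAr.
apply: mxder0_eq (mxder0_mulcr _ (mxder0_mulcl _ dD)) _.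
by rewrite /m -scalemxAr -scalemxAl.
Qed.

Lemma mexp_frob c s : `|c| <= 1 -> 0 <= s <= 1 ->
  frob (mexp c s) <= \sum_i expR `|mu 0 i| ^+ 2.
Proof.
move=> c1 /andP[s0 s1]; rewrite frob_spectral//; apply: ler_sum => i _.
rewrite mxE ler_pXn2r ?nnegrE ?expR_ge0// ler_expR.
apply: le_trans (ler_norm _) _; rewrite !normrM mulrA ger0_norm//.
rewrite ler_piMl//; apply: mulr_ile1 => //.
Qed.

(** The bound of [gram_klein] at [T] is a differentiable majorant of [lnsq] along the curve, equal
    to it at 0. Its derivative there is [4 * (tr (m ln (T T^T)) - tr (m ln (T^T T)))], nonpositive
    by hypothesis. *)
Lemma lnsq_descent (T : 'M[R]_d) : T \in unitmx ->
  (forall (a : 'rV[R]_d) (V : 'M[R]_d), V^T *m V = 1%:M ->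
     T *m T^T = V *m diag_mx a *m V^T ->
     \tr (m *m (V *m diag_mx (map_mx (@ln R) a) *m V^T)) <=
     \tr (m *m (T^T *m (V *m diag_mx (\row_i (ln (a 0 i) / a 0 i)) *m V^T) *m T))) ->
  exists gl : (R -> R) * R, [/\ der0 gl.1 gl.2, gl.2 <= 0, gl.1 0 = lnsq (T *m T^T) &
    forall s, 0 <= s <= 1 ->
      lnsq (adj_conj (mexp (-1) s) T *m (adj_conj (mexp (-1) s) T)^T) <= gl.1 s].
Proof.
move=> Tu Hm; pose b0 := \sum_i expR `|mu 0 i| ^+ 2.
have b00 : 0 <= b0 by apply: sumr_ge0 => i _; exact: sqr_ge0.
(* A bound for the squared norm on the whole curve; the summand 1 meets the requirement [1 <= be] of
   [gram_klein]. *)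
pose be := 1 + b0 * frob T * b0.
have be1 : 1 <= be by rewrite lerDl !mulr_ge0// frob_ge0.
have de0 : 0 < \det T ^+ 2 by rewrite exprn_even_gt0//= -unitfE -unitmxE.
have [K K0 HK] := @gram_klein R d be _ be1 de0.
pose Ts s := mexp 1 s *m T *m mexp (-1) s.
have TsE s : adj_conj (mexp (-1) s) T = Ts s.
  by rewrite adj_conjE ?mexp_det// mexp_inv opprK.
have Tsb s : 0 <= s <= 1 -> frob (Ts s) <= be.
  move=> s01; apply: (@le_trans _ _ (b0 * frob T * b0)); last by rewrite lerDr.
  apply: le_trans (frobM _ _) _; rewrite ler_pM ?frob_ge0//.
    apply: le_trans (frobM _ _) _; rewrite ler_wpM2r ?frob_ge0//.
    by apply: mexp_frob => //; rewrite normr1.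
  by apply: mexp_frob => //; rewrite normrN normr1.
have Ts0 : Ts 0 = T by rewrite /Ts !mexp0 mul1mx mulmx1.
have Tsd s : \det (Ts s) ^+ 2 = \det T ^+ 2.
  by rewrite /Ts det_mulmx mexp_det mulr1 det_mulmx mexp_det mul1r.
have Tb : frob T <= be by rewrite -Ts0; apply: Tsb; rewrite lexx ler01.
have [U' [UU' TE _ HU]] := HK _ Tb erefl.
have {}HU s : 0 <= s <= 1 -> _ := fun s01 => HU _ (Tsb _ s01) (Tsd s).
set a := eigs _ in TE HU; set G := U' *m _ *m _ in HU.
pose X s := Ts s *m (Ts s)^T - T *m T^T.
exists (fun s => lnsq (T *m T^T) + 2 * \tr (G *m X s) + K * frob (X s),
  2 * \tr (G *m (m *m (T *m T^T) - T *m m *m T^T - T *m m *m T^T + T *m T^T *m m))).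
have XE s : X s = mexp 1 s *m (T *m (mexp (-1) s *m (mexp (-1) s *m (T^T *m mexp 1 s)))) - T *m T^T.
  by rewrite /X /Ts trmx_mul mexp_tr trmx_mul mexp_tr !mulmxA.
have dX : mxder0 X (m *m (T *m T^T) - T *m m *m T^T - T *m m *m T^T + T *m T^T *m m).
  have dneg : mxder0 (mexp (-1)) (- m) by apply: mxder0_eq (mexp_der (-1)) _; rewrite scaleN1r.
  have dpos : mxder0 (mexp 1) m by apply: mxder0_eq (mexp_der 1) _; rewrite scale1r.
  have := mxder0_mul dpos (mxder0_mulcl T (mxder0_mul dneg (mxder0_mul dneg (mxder0_mulcl T^T dpos)))).
  rewrite !mexp0 !mulmx1 !mul1mx => H i j.
  have -> : (fun s => X s i j) = fun s => (mexp 1 s *m (T *m (mexp (-1) s *m (mexp (-1) s *m (T^T *m mexp 1 s))))) i j + (- (T *m T^T) i j).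
    by apply/funext => s; rewrite XE !mxE.
  apply: der0_eq (der0_add (H i j) (der0_cst _)) _; rewrite addr0.
  congr (fun_of_matrix _ i j); rewrite !mulmxDr !mulNmx !mulmxN !mulmxA.
  by rewrite !addrA.
have X0 : X 0 = 0 by rewrite /X Ts0 subrr.
split=> /=.
- apply: der0_eq (der0_add (der0_add (der0_cst _) (der0_mulc 2 (der0_trace (mxder0_mulcl G dX)))) (der0_mulc K (der0_frob0 dX X0))) _.
  by rewrite mulr0 addr0 add0r.
- have := Hm a U' UU' TE.
  set L1 := U' *m diag_mx (map_mx _ _) *m _; rewrite -/G => HmG.
  have diagC (x z : 'rV[R]_d) : U' *m diag_mx x *m U'^T *m (U' *m diag_mx z *m U'^T) =
      U' *m diag_mx (\row_i (x 0 i * z 0 i)) *m U'^T.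
    by rewrite -!mulmxA (mulmxA U'^T U') UU' mul1mx (mulmxA (diag_mx x)) mulmx_diag.
  have a0 := spectral_diag_gt0 Tu UU' TE.
  have AG : T *m T^T *m G = L1.
    rewrite TE diagC; congr (_ *m diag_mx _ *m _); apply/rowP => i; rewrite !mxE.
    by rewrite mulrCA divff ?mulr1// gt_eqF.
  have GA : G *m (T *m T^T) = L1.
    rewrite TE diagC; congr (_ *m diag_mx _ *m _); apply/rowP => i; rewrite !mxE.
    by rewrite divfK// gt_eqF.
  rewrite mulmxDr !mulmxBr !raddfD !raddfN /=.
  have -> : \tr (G *m (m *m (T *m T^T))) = \tr (m *m L1).
    by rewrite -AG mxtrace_mulC !mulmxA.
  have -> : \tr (G *m (T *m T^T *m m)) = \tr (m *m L1).
    by rewrite mulmxA GA mxtrace_mulC.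
  have -> : \tr (G *m (T *m m *m T^T)) = \tr (m *m (T^T *m G *m T)).
    by rewrite -mulmxA mulmxA mxtrace_mulC !mulmxA mxtrace_mulC !mulmxA.
  move: HmG; lra.
- by rewrite X0 mulmx0 mxtrace0 frobE mulmx0 mxtrace0 !mulr0 !addr0.
- move=> s s01; rewrite TsE; exact: HU.
Qed.

End Descent.

Lemma invmx_mul (K : comUnitRingType) m (A B : 'M[K]_m) : A \in unitmx -> B \in unitmx ->
  invmx (A *m B) = invmx B *m invmx A.
Proof.
move=> Au Bu; have ABu : A *m B \in unitmx by rewrite unitmx_mul Au.
by rewrite -[RHS]mulmx1 -(mulmxV ABu) !mulmxA -(mulmxA (invmx B)) mulVmx// mulmx1 mulVmx// mul1mx.
Qed.

(** * Vanishing of the traceless moment and self-adjointness *)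

Section SelfAdjoint.
Variables (R : realType) (d n : nat).
Notation N := #|{: {ffun 'I_n -> 'I_d}}|.

(** One moves along [h = exp (- s m)] with [m] the traceless part of the moment. The displacements
    have majorants that do not increase to first order by [lnsq_descent], while the volume term has
    one of derivative [-2 * phi * frob m]. *)
Lemma theta_decrease k (y : 'M[R]_(k, N)) q (Ts : 'I_q -> 'M[R]_d) (M : 'M[R]_d) phi :
  y *m y^T = 1%:M -> (forall i, Ts i \in unitmx) ->
  (forall i, exists s, y *m tens n (Ts i) = s *m y) -> M^T = M ->
  (forall x, \tr (y *m dtens n x *m y^T) = \tr (M *m x)) -> 0 < phi -> (0 < d)%N ->
  M - (\tr M / d%:R)%:M != 0 ->
  exists2 h : 'M[R]_d, \det h = 1 &
    phi * \det (y *m tens n (h *m h^T) *m y^T) +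
      \sum_i lnsq (adj_conj h (Ts i) *m (adj_conj h (Ts i))^T) <
    phi + \sum_i lnsq (Ts i *m (Ts i)^T).
Proof.
move=> yy Tu yT MT HM phi0 d0 m0; pose c := \tr M / d%:R.
set m := M - _ in m0; have mT : m^T = m by rewrite /m linearB /= MT tr_scalar_mx.
have trm : \tr m = 0.
  by rewrite /m raddfB /= mxtrace_scalar -[_ *+ d]mulr_natr divfK ?subrr// pnatr_eq0 -lt0n.
have [Om [mu [OmO mE]]] := symmetric_spectral mT.
have mu0 : \sum_i mu 0 i = 0 by rewrite -(spectral_trace mu OmO) -mE.
have desc i := @lnsq_descent R d Om mu OmO mu0 (Ts i) (Tu i).
have desc' i : exists gl : (R -> R) * R, [/\ der0 gl.1 gl.2, gl.2 <= 0,
    gl.1 0 = lnsq (Ts i *m (Ts i)^T) & forall s, 0 <= s <= 1 ->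
    lnsq (adj_conj (mexp Om mu (-1) s) (Ts i) *m (adj_conj (mexp Om mu (-1) s) (Ts i))^T) <= gl.1 s].
  apply: desc => a V VV TE; rewrite -mE.
  have [s sE] := yT i.
  have [H1 H2 H3] := moment_mono yy (Tu i) sE VV TE HM.
  (* The scalar part of [M] contributes the same to both sides since [\tr L1 = \tr L2]. *)
  rewrite /m !mulmxBl !raddfB /= !mul_scalar_mx !mxtraceZ H3 lerD2r.
  exact: le_trans H1 H2.
have [gl Hgl] := choice desc'.
pose z := y *m tens n Om.
(* In the eigenbasis of [m], [nu f] is the eigenvalue of [dtens n m] at the multi-index [f], and
   [p f] is the weight of the row space there. *)
pose p f := \sum_j z j f ^+ 2.
pose nu (f : 'I_N) := \sum_l mu 0 (ev f l).
have zz : z *m z^T = 1%:M.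
  by rewrite /z trmx_mul -mulmxA (mulmxA (tens n Om)) (orthogonal_tr (tens_orthogonal n OmO)) mul1mx.
have trz (b : 'rV[R]_N) : \tr (z *m diag_mx b *m z^T) = \sum_f p f * b 0 f.
  rewrite /mxtrace; under eq_bigr do rewrite diag_quad.
  rewrite exchange_big; apply: eq_bigr => f _; rewrite mulr_suml.
  by apply: eq_bigr => j _; rewrite expr2 mulrAC.
have p1 : \sum_f p f = k%:R.
  rewrite -(mxtrace1 R k) -zz -[X in X *m _]mulmx1 -diag_const_mx trz.
  by apply: eq_bigr => f _; rewrite mxE mulr1.
(* The moment pairs with [m] as [m] itself does, its scalar part being orthogonal to traceless
   matrices. *)
have pnu : \sum_f p f * nu f = frob m.
  have -> : frob m = \tr (M *m m).
    rewrite frobE mT {1}/m mulmxBl raddfB /= mul_scalar_mx mxtraceZ trm mulr0 subr0//.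
  rewrite -HM mE -dtens_conj ?orthogonal_tr// tens_tr dtens_diag !mulmxA -mulmxA -trmx_mul.
  by rewrite -/z trz; apply: eq_bigr => f _; rewrite mxE.
(* The majorant from [gram_det_exp]; the factor -2 comes from [h *m h^T = exp (-2 s m)]. *)
pose f s := phi * expR (\sum_j p j * expR (s * (-2 * nu j)) - k%:R).
have f0 : f 0 = phi.
  rewrite /f; under eq_bigr do rewrite mul0r expR0 mulr1.
  by rewrite p1 subrr expR0 mulr1.
have df : der0 f (phi * (-2 * frob m)).
  apply: der0_mulc.
  have dsum := der0_sum (index_enum _) (fun j => der0_mulc (p j) (der0_expc (-2 * nu j))).
  apply: der0_eq (der0_exp (der0_add dsum (der0_cst (- k%:R)))) _.
  under eq_bigr do rewrite mul0r expR0 mulr1.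
  rewrite p1 subrr expR0 mul1r addr0 -pnu mulr_sumr.
  by apply: eq_bigr => j _; rewrite mulrCA.
have dgl i : der0 (gl i).1 (gl i).2 by have [] := Hgl i.
have dG := der0_add df (der0_sum (index_enum _) dgl).
have l0 : phi * (-2 * frob m) + \sum_i (gl i).2 < 0.
  have gl0 : \sum_i (gl i).2 <= 0.
    by rewrite -oppr_ge0 -sumrN; apply: sumr_ge0 => i _; rewrite oppr_ge0; have [] := Hgl i.
  have phim : phi * (-2 * frob m) < 0.
    by rewrite pmulr_rlt0// mulNr oppr_lt0 mulr_gt0// frob_gt0.
  by rewrite -[ltRHS]addr0 ltr_leD.
have [s [s0 s1 Gs]] := der0_decrease dG l0.
have s01 : 0 <= s <= 1 by rewrite (ltW s0) s1.
exists (mexp Om mu (-1) s); first exact: mexp_det.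
have G0 : \sum_i (gl i).1 0 = \sum_i lnsq (Ts i *m (Ts i)^T).
  by apply: eq_bigr => i _; have [] := Hgl i.
rewrite f0 G0 in Gs; apply: le_lt_trans Gs; apply: lerD; last first.
  by apply: ler_sum => i _; have [_ _ _] := Hgl i; apply.
rewrite ler_pM2l// mexp_tr; set h := mexp Om mu (-1) s.
have hE : y *m tens n (h *m h) *m y^T = (y *m tens n h) *m (y *m tens n h)^T.
  by rewrite tensM trmx_mul -tens_tr mexp_tr !mulmxA.
rewrite hE; apply: le_trans (gram_det_exp _) _; rewrite -hE ler_expR lerD2r.
rewrite /h mexpM// /mexp !tensM tens_tr tens_diag.
have -> : y *m (tens n Om *m diag_mx (\row_j \prod_l
    (\row_i expR (s * ((-1 + -1) * mu 0 i))) 0 (ev j l)) *m (tens n Om)^T) *m y^T =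
    z *m diag_mx (\row_j \prod_l
    (\row_i expR (s * ((-1 + -1) * mu 0 i))) 0 (ev j l)) *m z^T.
  by rewrite /z trmx_mul !mulmxA.
rewrite trz le_eqVlt; apply/orP; left; apply/eqP; apply: eq_bigr => j _; congr (_ * _).
rewrite mxE; under eq_bigr do rewrite mxE.
have -> : s * (-2 * nu j) = \sum_l s * ((-1 + -1) * mu 0 (ev j l)).
  by rewrite /nu !mulr_sumr; apply: eq_bigr => l _; ring.
by rewrite expR_sum.
Qed.

(* Kempf-Ness: at a minimum of theta the moment of the row space of y is scalar, which
   forces equality in Jensen's inequality for every element of S. *)
Theorem kempf_ness k (y : 'M[R]_(k, N)) (S : set 'M[R]_d) :
  (0 < d)%N -> bi_irreducible S -> (forall g, S g -> g \in unitmx) -> row_free y ->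
  (forall g, S g -> (y *m tens n g <= y)%MS) ->
  exists2 h : 'M[R]_d, h \in unitmx &
    forall g, S g -> (y *m tens n (h *m h^T *m g^T *m invmx (h *m h^T)) <= y)%MS.
Proof.
move=> d0 irrS Su yfree yS.
(* Finitely many elements of [S] spanning it linearly are enough for the properness of [theta]. *)
have [q [Z [_ ZS SZ]]] := spanning_rows (fun v : 'rV[R]_(d * d) => S (vec_mx v)).
have {}SZ g : S g -> (mxvec g <= Z)%MS by move=> Sg; apply: SZ; rewrite mxvecK.
pose gs (i : 'I_q) : 'M[R]_d := vec_mx (row i Z).
have [h h1 hmin] := theta_min y d0 irrS SZ (fun i => Su _ (ZS i)).
have hu : h \in unitmx by rewrite unitmxE h1 unitr1.
exists h => //.
have yhfree : row_free (y *m tens n h).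
  by rewrite /row_free mxrankMfree// row_free_unit tens_unit.
have [u [y0 [uu yE yy]]] := orthonormalize yhfree.
have stable g : S g -> exists s, y0 *m tens n (invmx h *m g *m h) = s *m y0.
  move=> Sg; have /submxP [s sE] := yS _ Sg.
  exists (invmx u *m s *m u).
  rewrite -[y0 in LHS](mulKmx uu) -yE -!mulmxA -tensM !mulmxA mulmxV// mul1mx tensM.
  by rewrite -!mulmxA (mulmxA y) sE -!mulmxA yE.
have conjE g : adj_conj h g = invmx h *m g *m h by exact: adj_conjE.
have Tu g : g \in unitmx -> adj_conj h g \in unitmx.
  by move=> gu; rewrite conjE !unitmx_mul unitmx_inv hu gu.
have [M [MT HM']] := @dtens_trace R d n (y0^T *m y0) (gram_sym_tr y0).
have HM x : \tr (y0 *m dtens n x *m y0^T) = \tr (M *m x).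
  by rewrite -HM' mxtrace_mulC mulmxA.
have phi0 : 0 < \det u ^+ 2 by rewrite exprn_even_gt0//= -unitfE -unitmxE.
(* Passing to an orthonormal basis of the translated row space changes the squared volume by the
   constant [\det u ^+ 2]. *)
have detE (h' : 'M[R]_d) : \det (y *m tens n (h *m h' *m (h *m h')^T) *m y^T) =
    \det u ^+ 2 * \det (y0 *m tens n (h' *m h'^T) *m y0^T).
  have -> : y *m tens n (h *m h' *m (h *m h')^T) *m y^T =
      (y *m tens n h) *m tens n (h' *m h'^T) *m (y *m tens n h)^T.
    by rewrite !trmx_mul !tensM !tens_tr !mulmxA.
  rewrite yE trmx_mul.
  set t := tens n (h' *m h'^T).
  have -> : u *m y0 *m t *m (y0^T *m u^T) = u *m (y0 *m t *m y0^T) *m u^T by rewrite !mulmxA.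
  by rewrite det_mulmx det_mulmx det_tr; ring.
(* A nonscalar moment gives [h'] decreasing [theta] from [h] to [h *m h'], against minimality. *)
have [Mc|] := eqVneq (M - (\tr M / d%:R)%:M) 0; last first.
  have stable_gs i : exists s, y0 *m tens n (adj_conj h (gs i)) = s *m y0.
    by rewrite conjE; apply: stable; exact: ZS.
  move=> /(theta_decrease yy (fun i => Tu (gs i) (Su _ (ZS i))) stable_gs MT HM phi0 d0).
  move=> [h' h'1].
  rewrite ltNge => /negP[].
  have := hmin (h *m h'); rewrite det_mulmx h1 h'1 mulr1 => /(_ erefl).
  rewrite /theta -[h in \det (y *m tens n (h *m h^T) *m y^T)]mulmx1 !detE.
  rewrite trmx1 mulmx1 tens1 mulmx1 yy det1 mulr1.
  congr (_ <= _ + _); apply: eq_bigr => i _.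
  have hh1 : \det (h *m h') = 1 by rewrite det_mulmx h1 h'1 mulr1.
  have -> : adj_conj (h *m h') (gs i) = adj_conj h' (adj_conj h (gs i)).
    rewrite !adj_conjE// invmx_mul ?unitmxE ?h1 ?h'1 ?unitr1// !mulmxA//.
  by [].
have {}Mc : M = (\tr M / d%:R)%:M by apply/eqP; rewrite -subr_eq0 Mc.
move=> g Sg; have [s sE] := stable _ Sg.
set T := invmx h *m g *m h in sE.
have TTu : T \in unitmx by rewrite /T -conjE; apply: Tu; exact: Su.
have [U [UU TE]] := gram_eigs T.
have [H1 H2 H3] := moment_mono yy TTu sE UU TE HM.
have [_ Heq] := jensen_tens yy TTu sE UU TE.
(* For a scalar moment the two outer bounds of [moment_mono] coincide, as [\tr L1 = \tr L2]. *)
have [|t tE] := Heq.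
  rewrite HM; apply/eqP; rewrite eq_le H1 /=; apply: le_trans H2 _.
  by rewrite Mc !mul_scalar_mx !mxtraceZ H3.
have su := stable_coef_unit yy TTu sE.
(* Stability under [T] and [T *m T^T], with [s] invertible, gives stability under [T^T]. *)
have yT : y0 *m tens n T^T = invmx s *m t *m y0.
  rewrite -[y0 in LHS](mulKmx su) -sE -!mulmxA -tensM; congr (_ *m _).
  by rewrite tE.
have hhE : h *m h^T *m g^T *m invmx (h *m h^T) = h *m T^T *m invmx h.
  rewrite /T invmx_mul ?unitmx_tr// !trmx_mul trmx_inv !mulmxA.
  by [].
apply/submxP; exists (u *m (invmx s *m t) *m invmx u).
have y0E : y0 = invmx u *m (y *m tens n h) by rewrite yE mulKmx.
rewrite hhE !tensM !mulmxA yE -!mulmxA (mulmxA y0) yT.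
rewrite -!mulmxA; congr (_ *m _); rewrite !mulmxA -(mulmxA _ y0).
rewrite y0E -!mulmxA -tensM mulmxV// tens1 mulmx1 !mulmxA//.
Qed.

End SelfAdjoint.

(** * Duality between images and kernels *)

Section PluckerCoordinates.
Variables (R : realType) (d r : nat).
Notation N := #|{: {ffun 'I_r -> 'I_d}}|.
Implicit Types (C : 'M[R]_(r, d)) (V : 'M[R]_(d, r)).

(** Indexed by all maps and not only increasing ones: these are the coordinates of the exterior
    product of the rows of [C] as an alternating tensor. *)
Definition plucker C : 'rV[R]_N := \row_j \det (\matrix_(a, b) C a (ev j b)).

Definition pure_tensor V : 'cV[R]_N := \col_j \prod_b V (ev j b) b.

(** Cauchy-Binet before grouping: the sum runs over all choices of columns, and only one factor is
    antisymmetrised. *)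
Lemma det_mulmx_expand C V : \det (C *m V) =
  \sum_(f : {ffun 'I_r -> 'I_d}) \det (\matrix_(a, b) C a (f b)) * \prod_b V (f b) b.
Proof.
rewrite -[LHS]det_tr [LHS]/determinant.
transitivity (\sum_(s : 'S_r) \sum_(f : {ffun 'I_r -> 'I_d})
    (-1) ^+ s * (\prod_b C (s b) (f b)) * \prod_b V (f b) b).
  apply: eq_bigr => s _; rewrite -[RHS](eq_bigr _ (fun f _ => mulrA _ _ _)) -mulr_sumr.
  congr (_ * _); under [RHS]eq_bigr do rewrite -big_split /=.
  rewrite -(bigA_distr_bigA (fun b a => C (s b) a * V a b)).
  by apply: eq_bigr => b _; rewrite !mxE.
rewrite exchange_big; apply: eq_bigr => f _; rewrite -det_tr /determinant mulr_suml.
by apply: eq_bigr => s _; congr (_ * _ * _); apply: eq_bigr => b _; rewrite !mxE.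
Qed.

Lemma plucker_pure C V : plucker C *m pure_tensor V = (\det (C *m V))%:M.
Proof.
apply/matrixP => i j; rewrite !ord1 det_mulmx_expand mxE [RHS]mxE mulr1n.
rewrite -(@sum_enum_val R d r (fun f => \det (\matrix_(a, b) C a (f b)) * \prod_b V (f b) b)).
by apply: eq_bigr => l _; rewrite !mxE.
Qed.

Lemma plucker_tens C (g : 'M[R]_d) : plucker C *m tens r g = plucker (C *m g).
Proof.
apply/matrixP => i j; rewrite ord1 !mxE.
have -> : \matrix_(a, b) (C *m g) a (ev j b) = C *m \matrix_(a, b) g a (ev j b).
  by apply/matrixP => a b; rewrite !mxE; apply: eq_bigr => l _; rewrite mxE.
rewrite det_mulmx_expand -(@sum_enum_val R d r (fun f => \det (\matrix_(a, b) C a (f b)) *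
  \prod_b (\matrix_(a, b) g a (ev j b)) (f b) b)).
by apply: eq_bigr => l _; rewrite !mxE; congr (_ * _); apply: eq_bigr => b _; rewrite mxE.
Qed.

Lemma plucker_mull (A : 'M[R]_r) C : plucker (A *m C) = \det A *: plucker C.
Proof.
apply/matrixP => i j; rewrite !mxE -det_mulmx; congr (\det _).
by apply/matrixP => a b; rewrite !mxE; apply: eq_bigr => l _; rewrite mxE.
Qed.

Lemma gram_det_neq0 m n (X : 'M[R]_(m, n)) : row_free X -> \det (X *m X^T) != 0.
Proof.
move=> Xfree; apply/negP => /det0P [v v0 vXX].
have /frob_eq0 vX : frob (v *m X)^T = 0.
  by rewrite -frob_vecE trmxK trmx_mul mulmxA -(mulmxA v) vXX mul0mx mxE.
case/eqP: v0; apply/eqP; rewrite -(mulmx_free_eq0 _ Xfree); apply/eqP.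
by apply: trmx_inj; rewrite vX trmx0.
Qed.

Lemma left_right_transversal (S : set 'M[R]_d) :
  (0 < d)%N -> bi_irreducible S -> (forall g, S g -> g \in unitmx) ->
  (forall g h, S g -> S h -> S (g *m h)) ->
  left_transversal S r -> right_transversal S r.
Proof.
move=> d0 irrS Su SM LT V rV; apply: contrapT => nV.
pose CC C := exists B : 'M[R]_(d, r), [/\ \rank B = r, \rank C = r & real_cone_closure S (B *m C)].
have CV C : CC C -> \det (C *m V) = 0.
  move=> [B [rB rC SBC]]; apply/eqP; apply: contrapT => /negP.
  rewrite det_neq0_rank => /eqP rCV; apply: nV; exists (B *m C); split=> //.
    by rewrite -[B]mulmx1 mxrank_mul_full// mxrank1.
  by rewrite -mulmxA -[B *m _]mulmx1 mxrank_mul_full// ?mxrank1.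
have CCg C g : CC C -> S g -> CC (C *m g).
  move=> [B [rB rC SBC]] Sg; exists B; split; first exact: rB.
    by rewrite mxrankMfree// row_free_unit Su.
  by rewrite mulmxA; exact: (cone_closureM SM SBC (cone_closure_sub Sg)).
have [k [y [yfree yCC CCy]]] := spanning_rows (fun v : 'rV[R]_N => exists2 C, CC C & v = plucker C).
have yS g : S g -> (y *m tens r g <= y)%MS.
  move=> Sg; apply/row_subP => i; rewrite row_mul; have [C CC_C ->] := yCC i.
  by rewrite plucker_tens; apply: CCy; exists (C *m g); [exact: (CCg _ _ CC_C Sg)|].
have [h hu yh] := kempf_ness d0 irrS Su yfree yS.
pose P := h *m h^T; pose P' := invmx P.
have Pu : P \in unitmx by rewrite unitmx_mul unitmx_tr hu.
have PT : P^T = P by exact: gram_sym.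
have P'T : P'^T = P' by rewrite /P' trmx_inv PT.
(* [P *m p^T *m P'] is the adjoint of [p] for the scalar product [P] on rows. Preserving the row
   space of [y] is a closed condition stable under scaling, so it extends from [S] to the cone
   closure. *)
have yM p : real_cone_closure S p -> (y *m tens r (P *m p^T *m P') <= y)%MS.
  move=> Sp; rewrite submxE; apply/eqP/frob_eq0; move: p Sp.
  apply: cone_closure_min => [|l g Sg].
    apply: closed_preimage_eq; apply: continuous_frob.
    apply: continuous_mulmx; last exact: cst_continuous.
    apply: continuous_mulmx; first exact: cst_continuous.
    apply: continuous_tens; apply: continuous_mulmx; last exact: cst_continuous.
    apply: continuous_mulmx; first exact: cst_continuous.
    by apply: continuous_trmx => x; exact: cvg_id.
  rewrite /= trmxZ -scalemxAr -scalemxAl tensZ -scalemxAr -scalemxAl frobZ.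
  by have := yh _ Sg; rewrite submxE => /eqP ->; rewrite frobE mulmx0 mxtrace0 mulr0.
have yV : y *m pure_tensor V = 0.
  apply/row_matrixP => i; rewrite row_mul row0; have [C CC_C ->] := yCC i.
  by rewrite plucker_pure CV// raddf0.
(* Left transversality is applied to the orthogonal of the column space of [V] for the form [P']. *)
have [p [Sp rp rLp]] : exists p, [/\ real_cone_closure S p, \rank p = r &
    \rank (V^T *m P' *m p) = r].
  apply: LT; rewrite mxrankMfree ?mxrank_tr// row_free_unit unitmx_inv//.
have [B [C [pE rB rC]]] := rank_factorization rp.
have : (plucker C *m tens r (P *m p^T *m P') <= y)%MS.
  apply: submx_trans (yM _ Sp); apply: submxMr; apply: CCy; exists C => //.
  by exists B; split=> //; rewrite -pE.
(* The Gram determinant of [C] splits off, leaving the Plucker vector of the adjoint of [B]. *)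
have -> : plucker C *m tens r (P *m p^T *m P') = \det (C *m P *m C^T) *: plucker (B^T *m P').
  by rewrite plucker_tens pE trmx_mul !mulmxA -(mulmxA _ B^T) plucker_mull.
have CPC : \det (C *m P *m C^T) != 0.
  rewrite /P !mulmxA -mulmxA -trmx_mul; apply: gram_det_neq0.
  by rewrite /row_free mxrankMfree ?rC// row_free_unit.
rewrite eqmx_scale// => /submxP [w wE].
(* Membership in the row space of [y] makes the Plucker vector orthogonal to the pure tensor of [V],
   contrary to the transversality of [B]. *)
have : \det (B^T *m P' *m V) = 0.
  have := plucker_pure (B^T *m P') V; rewrite wE -(mulmxA w) yV mulmx0.
  by move=> /matrixP/(_ 0 0); rewrite !mxE mulr1n => <-.
rewrite -det_tr !trmx_mul P'T trmxK => /eqP; apply/negP.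
rewrite det_neq0_rank mulmxA; apply/eqP.
have := rLp; rewrite pE mulmxA => rLBC; apply/eqP.
rewrite eqn_leq rank_leq_row /=.
by have := mxrankM_maxl (V^T *m P' *m B) C; rewrite rLBC.
Qed.

End PluckerCoordinates.

(** * Transposition and the two equivalences *)

Lemma tr_image_involutive (R : realType) d (S : set 'M[R]_d) :
  [set g^T | g in [set g^T | g in S]] = S.
Proof.
apply/seteqP; split=> [_ [_ [g Sg <-] <-]|g Sg]; first by rewrite trmxK.
by exists g^T; [exists g|rewrite trmxK].
Qed.

(** Transposing exchanges the two transversality conditions, and the hypotheses are stable under
    it. *)
Lemma right_left_transversal (R : realType) d r (S : set 'M[R]_d) :
  (0 < d)%N -> bi_irreducible S -> (forall g, S g -> g \in unitmx) ->
  (forall g h, S g -> S h -> S (g *m h)) ->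
  right_transversal S r -> left_transversal S r.
Proof.
move=> d0 irrS Su SM RT L rL.
pose St := [set g^T | g in S].
have LT : left_transversal St r.
  move=> L' rL'; have [|p [Sp rp rpL]] := RT L'^T; first by rewrite mxrank_tr.
  exists p^T; split; [exact: cone_closure_tr|by rewrite mxrank_tr|].
  by rewrite -mxrank_tr trmx_mul trmxK.
have [||||p [Sp rp rpL]] := left_right_transversal d0 _ _ _ LT (V := L^T).
- exact: bi_irreducible_tr.
- by move=> _ [g Sg <-]; rewrite unitmx_tr Su.
- by move=> _ _ [g Sg <-] [g' Sg' <-]; exists (g' *m g); [exact: SM|rewrite trmx_mul].
- by rewrite mxrank_tr.
exists p^T; split.
- by rewrite -(tr_image_involutive S); exact: cone_closure_tr.
- by rewrite mxrank_tr.
- by rewrite -mxrank_tr trmx_mul trmxK.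
Qed.

Theorem lemma2p1 (R : realType) (d : nat) (Gamma : set 'M[R]_d)
  (Gamma_semigroup : subsemigroup_GL Gamma)
  (Gamma_irr : acts_irreducibly Gamma) :
  (property_S Gamma <-> property_S (zariski_closure_GL Gamma)) /\
  (property_S Gamma <->
   forall V : {vspace 'cV[R]_d}, \dim V = proximal_dim Gamma ->
     exists2 p, minimal_rank_set Gamma p & (V :&: lker (mx_end p))%VS = 0%VS).
Proof.
have [d0 _] := Gamma_irr.
have irr := irreducible_bi_irreducible Gamma_semigroup Gamma_irr.
have [r0 [p0 Gp0 rp0] rmin] := proximal_dim_min Gamma_semigroup d0.
have [B [C [p0E rB rC]]] := rank_factorization rp0.
have GBC : real_cone_closure Gamma (B *m C) by rewrite -p0E.
have [_ Gu GM] := Gamma_semigroup.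
have rd : (proximal_dim Gamma <= d)%N by rewrite -rp0 rank_leq_row.
(* Inclusion of the cone closures gives one inequality and [zariski_rank_min] the other one. *)
have dimE : proximal_dim (zariski_closure_GL Gamma) = proximal_dim Gamma.
  have p0_neq0 : p0 != 0 by rewrite -mxrank_eq0 rp0 -lt0n.
  have Zp0 : real_cone_closure (zariski_closure_GL Gamma) p0.
    by apply: cone_closure_mono Gp0; exact: zariski_sub.
  have [|[q [Zq /= /eqP q0] <-] min] := @proximal_dimP R d (zariski_closure_GL Gamma).
    by exists (\rank p0), p0 => //; split=> //; exact/eqP.
  apply/eqP; rewrite eqn_leq (zariski_rank_min Gamma_semigroup irr r0 rmin GBC rB rC)//=.
  by rewrite andbT -rp0; apply: min; exists p0 => //; split=> //; exact/eqP.
have SL := property_S_left rd.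
have SLZ : property_S (zariski_closure_GL Gamma) <->
    left_transversal (zariski_closure_GL Gamma) (proximal_dim Gamma).
  by rewrite -dimE; apply: property_S_left; rewrite dimE.
have LZ := zariski_left_transversal Gamma_semigroup irr r0 rmin GBC rB rC.
split; first by rewrite SL SLZ.
rewrite SL -right_transversalP; split.
  exact: left_right_transversal.
exact: right_left_transversal.
Qed.
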